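(* Let $\dim(\mathcal{X})<\infty$. Then for $\mathcal{T}=(T_1,\ldots,T_d)\in \mathcal{Z}$, $J_{w_p}(\mathcal{T})=co(\mathcal{B})$, where $$\mathcal{B}=\bigg\{\frac{1}{w_p(\mathcal{T})^{p-1}}\Big(\overline{x^*(T_1x)}|x^*(T_1x)|^{p-2}x^*\otimes x,\ldots,\overline{x^*(T_dx)}|x^*(T_dx)|^{p-2}x^*\otimes x\Big): (x,x^* )\in M_{w_p(\mathcal{T})},\ x\in E_{\mathcal{X}},\ x^*\in E_{\mathcal{X}^*}\bigg\}.$$
   Context: $\mathcal{X}$ is a Banach space over $\mathbb{F}$ ($\mathbb{R}$ or $\mathbb{C}$) with dual $\mathcal{X}^*$. For a normed space $\mathcal{Y}$, $S_{\mathcal{Y}}$ is its unit sphere and $E_{\mathcal{Y}}$ the set of extreme points of its closed unit ball. $co(A)$ is the convex hull of $A$. $\mathcal{L}(\mathcal{X})$ is the space of bounded linear operators on $\mathcal{X}$; $\Pi=\{(x,x^* ): x\in S_{\mathcal{X}},\ x^*\in S_{\mathcal{X}^*},\ x^*(x)=1\}$. Standing assumption: the numerical radius $w(T)=\sup\{|x^*(Tx)|:(x,x^* )\in\Pi\}$ is a norm on $\mathcal{L}(\mathcal{X})$ (automatic if $\mathbb{F}=\mathbb{C}$). Fix an integer $d\ge 1$ and $1<p<\infty$. The joint numerical radius of $\mathcal{T}=(T_1,\ldots,T_d)\in\mathcal{L}(\mathcal{X})^d$ is $w_p(\mathcal{T})=\sup\{(\sum_{i=1}^d|x^*(T_ix)|^p)^{1/p}:(x,x^*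 )\in\Pi\}$, and $\mathcal{Z}=(\mathcal{L}(\mathcal{X})^d,w_p(\cdot))$, with dual $\mathcal{Z}^*$ carrying the dual norm. $J_{w_p}(\mathcal{T})=\{f\in S_{\mathcal{Z}^*}:f(\mathcal{T})=w_p(\mathcal{T})\}$, and $M_{w_p(\mathcal{T})}=\{(x,x^* )\in\Pi:(\sum_{i=1}^d|x^*(T_ix)|^p)^{1/p}=w_p(\mathcal{T})\}$. For $\alpha_i\in\mathbb{F}$, $(\alpha_1x^*\otimes x,\ldots,\alpha_dx^*\otimes x)$ denotes the linear functional $(T_1,\ldots,T_d)\mapsto\sum_{i=1}^d\alpha_i x^*(T_ix)$ on $\mathcal{L}(\mathcal{X})^d$. Convention: $\overline{a}|a|^{p-2}$ means $0$ when $a=0$.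
   Formalization: The theorem is stated for nonzero T only: at T = 0 one has w_p(T) = 0, so the factor 1/w_p(T)^{p-1} in the definition of B is undefined. *)

(* Defs.v *)
From HB Require Import structures.
From mathcomp Require Import all_boot all_order all_algebra complex.
From mathcomp Require Import all_classical all_reals all_analysis.

Set Implicit Arguments.
Unset Strict Implicit.
Unset Printing Implicit Defensive.

Import Order.TTheory GRing.Theory Num.Theory.
Import numFieldNormedType.Exports.

Local Open Scope classical_set_scope.
Local Open Scope ring_scope.

(* The scalar field is either R or C = R[i]. Norms in a normedModType over R[i]
   are R[i]-valued, so suprema and real powers are taken after projecting them
   to R with [scalar_re]. *)
Variant scalar_kind := RealScalars | ComplexScalars.

Definition scalar_field (R : realType) (s : scalar_kind) : numFieldType :=
  match s with
  | RealScalars => R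
  | ComplexScalars => R[i]
  end.

Section Scalars.
Context {R : realType} {s : scalar_kind}.

Definition scalar_re : scalar_field R s -> R :=
  match s return scalar_field R s -> R with
  | RealScalars => fun a => a
  | ComplexScalars => fun a => complex.Re a
  end.

Definition scalar_of_real : R -> scalar_field R s :=
  match s return R -> scalar_field R s with
  | RealScalars => fun r => r
  | ComplexScalars => fun r => Complex r 0
  end.

Definition scalar_conj : scalar_field R s -> scalar_field R s :=
  match s return scalar_field R s -> scalar_field R s with
  | RealScalars => fun a => a
  | ComplexScalars => fun a => conjc a
  end.

Definition scalar_abs (a : scalar_field R s) : R := scalar_re `|a|.

End Scalars.

Section Convexity.
Context {K : numFieldType} {V : lmodType K}.
Implicit Type A : set V.

(* For K = R[i], a weight with 0 <= t <= 1 is necessarily real. *)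
Definition convex_hull A : set V := smallest (@convex_set K V) A.

Definition extreme_points A : set V :=
  [set x | A x /\ forall (y z : V) (t : K), A y -> A z -> 0 < t -> t < 1 ->
     x = t *: y + (1 - t) *: z -> y = x /\ z = x].

End Convexity.

Section NormedSpaces.
Context {R : realType} {s : scalar_kind}.
Local Notation F := (scalar_field R s).

Definition is_norm (V : lmodType F) (N : V -> R) : Prop :=
  [/\ forall v, 0 <= N v,
      forall v, N v = 0 -> v = 0,
      forall (a : F) v, N (a *: v) = scalar_abs a * N v
    & forall u v, N (u + v) <= N u + N v].

Definition bounded_linear (U V : lmodType F) (NU : U -> R) (NV : V -> R) :
    set (U -> V) :=
  [set f | linear f /\ exists M : R, forall u, NV (f u) <= M * NU u].

(* The dual of (V, N), as a set of functions in the space V -> F. *)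
Definition dual (V : lmodType F) (N : V -> R) : set (V -> F^o) :=
  bounded_linear N (scalar_abs : F^o -> R).

(* Only meaningful on [dual N], where the supremum is finite. *)
Definition dual_norm (V : lmodType F) (N : V -> R) (f : V -> F^o) : R :=
  sup [set scalar_abs (f v) | v in [set v | N v <= 1]].

Definition dual_sphere (V : lmodType F) (N : V -> R) : set (V -> F^o) :=
  [set f | dual N f /\ dual_norm N f = 1].

Definition dual_ball (V : lmodType F) (N : V -> R) : set (V -> F^o) :=
  [set f | dual N f /\ dual_norm N f <= 1].

End NormedSpaces.

Section Operators.
Context {R : realType} {s : scalar_kind}.
Local Notation F := (scalar_field R s).

Definition vnorm (X : normedModType F) (x : X) : R := scalar_re `|x|.

Definition finite_dimensional (V : lmodType F) : Prop :=
  exists (n : nat) (e : 'I_n -> V),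
    forall v, exists c : 'I_n -> F, v = \sum_(i < n) c i *: e i.

Lemma scalar_re_le (a b : F) : a <= b -> scalar_re a <= scalar_re b.
Proof. by case: s a b => [//|[a a'] [b b']] /=; rewrite lecE => /andP[]. Qed.

Lemma scalar_reD (a b : F) : scalar_re (a + b) = scalar_re a + scalar_re b.
Proof. by case: s a b => [//|[a a'] [b b']]. Qed.

Lemma scalar_re_normM (a b : F) :
  scalar_re (`|a| * `|b|) = scalar_re `|a| * scalar_re `|b|.
Proof.
by case: s a b => [//|[a a'] [b b']] /=; rewrite !mulr0 subr0.
Qed.

Lemma vnormD (X : normedModType F) (x y : X) :
  vnorm (x + y) <= vnorm x + vnorm y.
Proof. by rewrite /vnorm -scalar_reD scalar_re_le// ler_normD. Qed.

Lemma vnormZ (X : normedModType F) (a : F) (x : X) :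
  vnorm (a *: x) = scalar_abs a * vnorm x.
Proof. by rewrite /vnorm normrZ -[`|x|]normr_id scalar_re_normM. Qed.

Lemma vnorm0 (X : normedModType F) : vnorm (0 : X) = 0.
Proof. by rewrite /vnorm normr0; case: s. Qed.

Lemma scalar_abs_ge0 (a : F) : 0 <= scalar_abs a.
Proof.
by have := scalar_re_le (normr_ge0 a); rewrite /scalar_abs; case: s a.
Qed.

End Operators.

Section BoundedOperators.
Context {R : realType} {s : scalar_kind}.
Local Notation F := (scalar_field R s).
Variable X : normedModType F.

Definition bounded_op_pred : {pred X -> X} :=
  mem (bounded_linear (@vnorm _ _ X) (@vnorm _ _ X)).

Lemma bounded_op_submod : submod_closed bounded_op_pred.
Proof.
split.
  rewrite inE; split; last first.
    by exists 0 => x; rewrite vnorm0 mul0r.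
  by move=> a x y; rewrite /= scaler0 addr0.
move=> a f g; rewrite !inE => -[lf [M fM]] [lg [N gN]]; split.
  move=> b x y.
  change (a *: f (b *: x + y) + g (b *: x + y) =
    b *: (a *: f x + g x) + (a *: f y + g y)).
  by rewrite lf lg !scalerDr !scalerA [b * a]mulrC addrACA.
exists (scalar_abs a * M + N) => x; rewrite mulrDl -mulrA.
apply: (le_trans (vnormD _ _)); rewrite lerD//= vnormZ.
by rewrite ler_wpM2l ?scalar_abs_ge0.
Qed.

HB.instance Definition _ :=
  GRing.isSubmodClosed.Build F (X -> X) bounded_op_pred bounded_op_submod.

(* The space L(X), as a subspace of the space of all maps X -> X. *)
Record bounded_op := BoundedOp {
  bounded_op_fun :> X -> X;
  _ : bounded_op_fun \in bounded_op_pred }.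

HB.instance Definition _ := [isSub for bounded_op_fun].
HB.instance Definition _ := [Choice of bounded_op by <:].
HB.instance Definition _ := [SubChoice_isSubLmodule of bounded_op by <:].

End BoundedOperators.

Section JointNumericalRadius.
Context {R : realType} {s : scalar_kind}.
Local Notation F := (scalar_field R s).
Context {X : normedModType F}.

Definition state_pairs : set (X * (X -> F^o)) :=
  [set u | [/\ vnorm u.1 = 1, dual_sphere (@vnorm _ _ X) u.2 & u.2 u.1 = 1]].

Definition numerical_radius (S : bounded_op X) : R :=
  sup [set scalar_abs (u.2 (S u.1)) | u in state_pairs].

Context {d : nat}.
Local Notation Z := {ffun 'I_d -> bounded_op X}.

Definition joint_value (p : R) (T : Z) (u : X * (X -> F^o)) : R :=
  (\sum_(i < d) scalar_abs (u.2 (T i u.1)) `^ p) `^ p^-1.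

Definition joint_numerical_radius (p : R) (T : Z) : R :=
  sup [set joint_value p T u | u in state_pairs].

Definition norming_functionals (p : R) (T : Z) : set (Z -> F^o) :=
  [set f | dual_sphere (joint_numerical_radius p) f /\
           f T = scalar_of_real (joint_numerical_radius p T)].

Definition attaining_pairs (p : R) (T : Z) : set (X * (X -> F^o)) :=
  [set u | state_pairs u /\ joint_value p T u = joint_numerical_radius p T].

(* (a_1 x* (x) x, ..., a_d x* (x) x) as a functional on L(X)^d *)
Definition tensor_functional (a : 'I_d -> F) (u : X * (X -> F^o)) : Z -> F^o :=
  fun S => \sum_(i < d) a i * u.2 (S i u.1).

(* The value is 0 at a = 0, since then [scalar_conj a = 0]. *)
Definition conj_powR (p : R) (a : F) : F :=
  scalar_conj a * scalar_of_real (scalar_abs a `^ (p - 2)).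

Definition extreme_functionals (p : R) (T : Z) : set (Z -> F^o) :=
  [set scalar_of_real ((joint_numerical_radius p T `^ (p - 1))^-1) *:
       tensor_functional (fun i => conj_powR p (u.2 (T i u.1))) u
  | u in [set u | [/\ attaining_pairs p T u,
      extreme_points [set x : X | vnorm x <= 1] u.1
    & extreme_points (dual_ball (@vnorm _ _ X)) u.2]]].

End JointNumericalRadius.

(* Main.v *)
Require Import Defs.
From HB Require Import structures.
From mathcomp Require Import all_boot all_order all_algebra complex.
From mathcomp Require Import all_classical all_reals all_analysis.
From mathcomp Require Import ring lra.

(** Let [q] be the exponent conjugate to [p], and let [K] be the set of unit
    tensors, the functionals [S |-> \sum_i a_i y(S_i x)] with [(x, y)] a
    state pair and [\sum_i |a_i|^q <= 1]. Hoelder's inequality and its equality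
    case say that the supremum of [|g S|] over [g] in [K] is the joint numerical
    radius of [S]. So the unit ball of the dual norm is the closed convex hull
    of [K]. As [K] is compact ([unit_tensors_compact]) and the space of operator
    tuples is finite-dimensional, every [f] in that ball is a convex combination
    of extreme points of [K] ([dual_krein_milman]).

    If moreover [f T] is the joint numerical radius of [T], the same holds for
    each extreme point [g] used in the combination, because the real part of
    [g T] cannot exceed it ([convex_hull_face]). For such a [g], built from [a]
    and [(x, y)], equality holds in Hoelder's inequality. Hence [(x, y)]
    attains the joint numerical radius of [T] and [a] is the vector displayed in
    the theorem ([norming_weights_uniq]). The vectors [x] and [y] are extreme
    because [g] is: in a decomposition [x = t x1 + (1 - t) x2] in the unit ball,
    [y x = 1] forces [y x1 = y x2 = 1], so [g] is decomposed inside [K] in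
    the same proportion. As [g] is extreme, the pieces equal [g], and testing on
    operators of rank one gives [x1 = x2 = x] ([tensor_extreme_vec]); the
    argument for [y] is symmetric ([tensor_extreme_dual]). This gives one inclusion.
    The other one follows from Hoelder's inequality and the convexity of the set
    of norming functionals.

    The Krein-Milman theorem used here contains the theorems of Minkowski and
    Milman: a point that no linear functional separates strictly from a compact
    [K] in a finite-dimensional real space is a convex combination of extreme
    points of [K] ([dominated_convex_hull]). The proof is by induction on the
    dimension. A point with a nonzero supporting functional is handled in the
    supporting hyperplane, and any other point lies between two such points.

    Real and complex scalars are treated together through real and imaginary
    parts. The assumption that the numerical radius is a norm makes the joint
    numerical radius of [T] positive, and in particular provides state pairs. *)

Set Implicit Arguments.
Unset Strict Implicit.
Unset Printing Implicit Defensive.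

Import Order.TTheory GRing.Theory Num.Theory.
Import numFieldNormedType.Exports.
Local Open Scope classical_set_scope.
Local Open Scope ring_scope.

(** * Convex hulls *)

Section ConvexHull.
Context {K : numFieldType} {V : lmodType K}.
Implicit Types A B : set V.

Lemma convex_setP A : convex_set A <->
  forall (x y : V) (t : K), A x -> A y -> 0 < t -> t < 1 ->
    A (t *: x + (1 - t) *: y).
Proof.
split=> [/convex_setW cA x y t Ax Ay t0 t1|cA].
  have t01 : 0 <= t <= 1 by rewrite !ltW.
  have := cA x y (mem_set Ax) (mem_set Ay) (Itv01 (ltW t0) (ltW t1)) t0 t1.
  by rewrite inE.
by apply/convex_setW => x y /set_mem Ax /set_mem Ay k k0 k1;
  apply/mem_set; exact: cA.
Qed.

Lemma sub_convex_hull A : A `<=` convex_hull A.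
Proof. exact: sub_smallest. Qed.

Lemma convex_hull_min A B : A `<=` B ->
  (forall (x y : V) (t : K), B x -> B y -> 0 < t -> t < 1 ->
    B (t *: x + (1 - t) *: y)) -> convex_hull A `<=` B.
Proof.
move=> AB cB; apply: smallest_sub => //.
by apply/(@convex_setP B).
Qed.

Lemma convex_hull_convex A (x y : V) (t : K) : convex_hull A x ->
  convex_hull A y -> 0 < t -> t < 1 -> convex_hull A (t *: x + (1 - t) *: y).
Proof.
move=> hx hy t0 t1 B [cB AB].
by apply: (convex_setP B).1 => //; [exact: hx|exact: hy].
Qed.

Lemma convex_hullS A B : A `<=` B -> convex_hull A `<=` convex_hull B.
Proof.
by move=> AB; apply: convex_hull_min;
  [move=> x /AB; exact: sub_convex_hull|exact: convex_hull_convex].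
Qed.

End ConvexHull.

(** * The Krein-Milman theorem in real coordinate spaces *)

Section KreinMilman.
Context {R : realType}.

Definition dotv n (l x : 'rV[R]_n) : R := \sum_i l ord0 i * x ord0 i.

Lemma sum_continuous (T : topologicalType) (I : Type) (r : seq I) (P : pred I)
    (g : I -> T -> R) : (forall i, P i -> continuous (g i)) ->
  continuous (fun x => \sum_(i <- r | P i) g i x).
Proof.
move=> cg x; rewrite /continuous_at; elim: r => [|i r IH].
  by under eq_fun do rewrite big_nil; rewrite big_nil; exact: cvg_cst.
under eq_fun do rewrite big_cons; rewrite big_cons; case: ifPn => [Pi|_] //.
by apply: cvgD; [exact: cg|exact: IH].
Qed.

Lemma ler_coord_norm n (x : 'rV[R]_n) i : `|x ord0 i| <= `|x|.
Proof.
rewrite [leRHS]/Num.norm/= mx_normrE; apply/bigmax_geP; right.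
by exists (ord0, i).
Qed.

Lemma row_continuous (T : topologicalType) n (g : T -> 'rV[R]_n) :
  (forall i, continuous (fun x => g x ord0 i)) -> continuous g.
Proof.
move=> cg x; apply/cvg_ballP => e e0; near=> y; split=> // i j.
rewrite (ord1 i); move: j; near: y; apply: filter_forall => j.
by apply: (cg j x); exact: nbhsx_ballx.
Unshelve. all: by end_near. Qed.

Section Dotv.
Variable n : nat.
Implicit Types l x : 'rV[R]_n.

Lemma dotvC l x : dotv l x = dotv x l.
Proof. by apply: eq_bigr => i _; rewrite mulrC. Qed.

Lemma dotvDr l x y : dotv l (x + y) = dotv l x + dotv l y.
Proof. by rewrite -big_split; apply: eq_bigr => i _; rewrite !mxE mulrDr. Qed.

Lemma dotvZr l a x : dotv l (a *: x) = a * dotv l x.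
Proof. by rewrite mulr_sumr; apply: eq_bigr => i _; rewrite !mxE mulrCA. Qed.

Lemma dotvBr l x y : dotv l (x - y) = dotv l x - dotv l y.
Proof. by rewrite -scaleN1r dotvDr dotvZr mulN1r. Qed.

Lemma dotvDl l l' x : dotv (l + l') x = dotv l x + dotv l' x.
Proof. by rewrite ![dotv _ x]dotvC dotvDr. Qed.

Lemma dotvZl l a x : dotv (a *: l) x = a * dotv l x.
Proof. by rewrite ![dotv _ x]dotvC dotvZr. Qed.

Lemma dotv_continuous l : continuous (dotv l).
Proof.
apply: sum_continuous => i _ x.
apply: (@continuousM _ _ (fun=> l ord0 i) (fun M : 'rV_n => M ord0 i)).
  exact: cst_continuous.
exact: coord_continuous.
Qed.

Lemma dotv_gt0 x : x != 0 -> 0 < dotv x x.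
Proof.
move=> x0; rewrite lt_neqAle sumr_ge0 ?andbT; last first.
  by move=> i _; rewrite -expr2 sqr_ge0.
apply: contra x0 => /eqP/esym/eqP.
rewrite psumr_eq0; last by move=> i _; rewrite -expr2 sqr_ge0.
move=> /allP x0; apply/eqP/rowP => i; rewrite mxE; apply/eqP.
by have := x0 i (mem_index_enum i); rewrite /= mulf_eq0 orbb.
Qed.

End Dotv.

(** In place of a convergent subsequence: lower bounds that hold along the
    sequence up to [O(1/k)] pass to a cluster point. *)
Lemma compact_cluster_ge (T : topologicalType) (K : set T) (u : nat -> T) :
  compact K -> (forall k, K (u k)) ->
  exists2 x, K x & forall (g : T -> R) (c C : R), continuous g ->
    (forall k, c - C / k.+1%:R <= g (u k)) -> c <= g x.
Proof.
move=> cK Ku.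
have [|x [Kx clx]] := cK (u @ \oo) _.
  by exists 0%N => // k _; exact: Ku.
exists x => // g c C cg gu; apply/ler_addgt0Pr => e e0.
have e20 : 0 < e / 2 by rewrite divr_gt0.
have [N _ NC] : \forall k \near \oo, C / k.+1%:R < e / 2.
  have : (fun k => C * harmonic k) @ \oo --> C * 0.
    by apply: cvgM; [exact: cvg_cst|exact: cvg_harmonic].
  by rewrite mulr0 => /cvgr_lt; apply.
have [|_ [[k Nk <-] gk]] := clx (u @` [set k | (N <= k)%N])
    (g @^-1` ball (g x) (e / 2)) _ (cg x _ (nbhsx_ballx _ _ e20)).
  by exists N => // k Nk; exists k.
have := gu k; have := NC k Nk; move: gk.
rewrite /ball/= ltr_norml; move: (C / _) => z /andP[]; lra.
Qed.

(** [dominated K f] says that [f] lies in the closed convex hull of [K], in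
    dual terms: no linear functional separates [f] strictly from [K]. *)
Definition dominated n (K : set 'rV[R]_n) (f : 'rV[R]_n) :=
  forall l, exists2 a, K a & dotv l f <= dotv l a.

Lemma dotv_max n (K : set 'rV[R]_n) l : compact K -> K !=set0 ->
  exists2 a, K a & forall b, K b -> dotv l b <= dotv l a.
Proof.
move=> cK K0; have [|c cK' mc] := @EVT_max_rV R n (dotv l) K K0 cK.
  by apply: continuous_subspaceT => x; exact: dotv_continuous.
  by exists c; [exact/set_mem|move=> b /mem_set/mc].
Qed.

(** Perturbing a supporting functional [l] in the direction [l'] produces points
    of [K] that are nearly maximal for [l] and at least as large as [f] for [l'];
    their cluster point lies in the face cut out by [l]. *)
Lemma dominated_face n (K : set 'rV[R]_n) f l : compact K -> dominated K f ->
  (forall a, K a -> dotv l a <= dotv l f) ->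
  dominated (K `&` [set a | dotv l a = dotv l f]) f.
Proof.
move=> cK Kf lf l'.
have [a0 Ka0 _] := Kf 0.
have [m Km mmax] := dotv_max l' cK (ex_intro _ a0 Ka0).
pose C := dotv l' m - dotv l' f.
have /choice[u hu] k : exists a, K a /\
    dotv l f + dotv l' f / k.+1%:R <= dotv l a + dotv l' a / k.+1%:R.
  have [a Ka] := Kf (l + k.+1%:R^-1 *: l').
  by rewrite !dotvDl !dotvZl ![_^-1 * _]mulrC; exists a.
have [a Ka amax] := compact_cluster_ge cK (fun k => (hu k).1).
exists a.
  split => //=; apply/eqP; rewrite eq_le lf//=.
  apply: (amax (dotv l) _ C); first exact: dotv_continuous.
  move=> k; have [Kk] := hu k; have := mmax _ Kk; rewrite /C.
  have : 0 < k.+1%:R^-1 :> R by rewrite invr_gt0.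
  move: (k.+1%:R^-1) => e; nra.
apply: (amax (dotv l') _ 0); first exact: dotv_continuous.
move=> k; have [Kk] := hu k; have := lf _ Kk.
have : 0 < k.+1%:R^-1 :> R by rewrite invr_gt0.
move: (k.+1%:R^-1) => e; nra.
Qed.

(** Leaving [f] in a direction [v], the last dominated point has a nonzero
    supporting functional: a limit of normalized functionals separating the
    points just beyond it. *)
Lemma dominated_exit n (K : set 'rV[R]_n) f v : compact K -> dominated K f ->
  v != 0 -> exists t l, [/\ 0 <= t, l != 0, dominated K (f + t *: v) &
    forall a, K a -> dotv l a <= dotv l (f + t *: v)].
Proof.
move=> cK Kf v0.
have [a0 Ka0 _] := Kf 0.
have K0 : K !=set0 by exists a0.
pose S := [set t | 0 <= t /\ dominated K (f + t *: v)].
have S0 : S 0 by split => //; rewrite scale0r addr0.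
have bS : has_ubound S.
  have [m Km mmax] := dotv_max v cK K0.
  exists ((dotv v m - dotv v f) / dotv v v) => t [t0 /(_ v)[a Ka]].
  rewrite ler_pdivlMr ?dotv_gt0// dotvDr dotvZr => h.
  by have := mmax _ Ka; lra.
have hS : has_sup S by split => //; exists 0.
set t := sup S.
have t0 : 0 <= t by exact: ub_le_sup.
have Kt : dominated K (f + t *: v).
  move=> l; have [m Km mmax] := dotv_max l cK K0; exists m => //.
  have h s : S s -> dotv l f + s * dotv l v <= dotv l m.
    move=> [_ /(_ l)[a /mmax]]; rewrite dotvDr dotvZr => + h.
    exact: le_trans.
  rewrite dotvDr dotvZr; have [lv|lv] := leP (dotv l v) 0.
    by have := h _ S0; rewrite mul0r; nra.
  rewrite addrC -lerBrDr -ler_pdivlMr//; apply: ge_sup; first by exists 0.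
  by move=> s /h ?; rewrite ler_pdivlMr//; lra.
have /choice[u hu] k : exists l : 'rV[R]_n, `|l| = 1 /\
    forall a, K a -> dotv l a <= dotv l (f + (t + k.+1%:R^-1) *: v).
  have : ~ dominated K (f + (t + k.+1%:R^-1) *: v).
    move=> Kk.
    have /(ub_le_sup bS) : S (t + k.+1%:R^-1) by split; rewrite ?addr_ge0.
    by rewrite gerDl leNgt invr_gt0 ltr0n.
  move=> /existsNP[l hl].
  have hl' a : K a -> dotv l a < dotv l (f + (t + k.+1%:R^-1) *: v).
    by move=> Ka; rewrite ltNge; apply/negP => h; apply: hl; exists a.
  have l0 : l != 0.
    apply/eqP => l0; have := hl' _ Ka0.
    by rewrite l0 -(scale0r (0 : 'rV_n)) !dotvZl !mul0r ltxx.
  exists (`|l|^-1 *: l); split.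
    by rewrite normrZ normfV normr_id mulVf// normr_eq0.
  by move=> a /hl' /ltW h; rewrite !dotvZl ler_wpM2l// invr_ge0.
have cS : compact [set l : 'rV[R]_n | `|l| = 1].
  apply: bounded_closed_compact.
    by exists 1; split => // M M1 l /= ->; exact: ltW.
  apply: (@closed_comp _ _ (fun l : 'rV[R]_n => `|l|) [set 1]).
    by move=> l _; exact: norm_continuous.
  exact: closed_eq.
have [l l1 lmax] := compact_cluster_ge cS (fun k => (hu k).1).
exists t, l; split => //.
  by rewrite -normr_eq0 l1 oner_eq0.
move=> a Ka.
have := lmax (dotv ((f + t *: v) - a)) 0 (\sum_i `|v ord0 i|).
rewrite dotvC dotvBr subr_ge0; apply; first exact: dotv_continuous.
move=> k; have [uk1 /(_ a Ka)] := hu k.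
rewrite [dotv (_ - a) _]dotvC dotvBr !dotvDr !dotvZr mulrDl => h.
have : dotv (u k) v <= \sum_i `|v ord0 i|.
  apply: ler_sum => i _; rewrite (le_trans (ler_norm _))// normrM.
  by rewrite ler_piMl// -uk1; exact: ler_coord_norm.
have : 0 < k.+1%:R^-1 :> R by rewrite invr_gt0.
move: h; move: (k.+1%:R^-1) => e; nra.
Qed.

(** Coordinates on the affine hyperplane [dotv l x = c] when [l] has a nonzero
    [j]-th coordinate: [col' j] forgets that coordinate and [hyperplane_lift]
    restores it. *)
Definition hyperplane_lift n (l : 'rV[R]_n.+1) (c : R) (j : 'I_n.+1)
    (y : 'rV[R]_n) : 'rV[R]_n.+1 :=
  \row_i if unlift j i is Some i' then y ord0 i'
         else (c - dotv (col' j l) y) / l ord0 j.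

Lemma dotv_col' n (l x : 'rV[R]_n.+1) j :
  dotv l x = l ord0 j * x ord0 j + dotv (col' j l) (col' j x).
Proof.
rewrite /dotv (bigD1_ord j)//=; congr (_ + _).
by apply: eq_bigr => i _; rewrite !mxE.
Qed.

Lemma col'_lift n (l : 'rV[R]_n.+1) c j x : l ord0 j != 0 ->
  dotv l x = c -> hyperplane_lift l c j (col' j x) = x.
Proof.
move=> lj lx; apply/rowP => i; rewrite mxE.
case: unliftP => [i' ->|->]; first by rewrite mxE.
by rewrite -lx (dotv_col' _ _ j) addrK mulrAC divff// mul1r.
Qed.

Lemma hyperplane_lift_conv n (l : 'rV[R]_n.+1) c j t (y z : 'rV[R]_n) :
  hyperplane_lift l c j (t *: y + (1 - t) *: z) =
  t *: hyperplane_lift l c j y + (1 - t) *: hyperplane_lift l c j z.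
Proof.
apply/rowP => i; rewrite !mxE; case: unliftP => [i' _|_].
  by rewrite !mxE.
by rewrite dotvDr !dotvZr; ring.
Qed.

(** The inductive step for a supported point: [K] is cut with the supporting
    hyperplane, whose section of [K] is projected one dimension lower. Extreme
    points of the section are extreme in [K] because the hyperplane supports
    [K]. *)
Lemma dominated_supported n (K : set 'rV[R]_n.+1) f l :
  (forall (K' : set 'rV[R]_n) f', compact K' -> dominated K' f' ->
    convex_hull (extreme_points K') f') ->
  compact K -> dominated K f -> l != 0 ->
  (forall a, K a -> dotv l a <= dotv l f) ->
  convex_hull (extreme_points K) f.
Proof.
move=> IH cK Kf l0 lf.
have /rV0Pn[j lj] := l0.
set c := dotv l f in lf.
have Kc := dominated_face cK Kf lf.
have ccol : continuous (@col' R 1 n.+1 j).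
  apply: row_continuous => i x; rewrite /continuous_at.
  by under eq_fun do rewrite mxE; rewrite mxE; exact: coord_continuous.
have cK' : compact (col' j @` (K `&` [set a | dotv l a = c])).
  apply: continuous_compact.
    by apply: continuous_subspaceT => x; exact: ccol.
  apply: compact_closedI => //.
  apply: (@closed_comp _ _ (dotv l) [set c]); last exact: closed_eq.
  by move=> x _; exact: dotv_continuous.
have : convex_hull (extreme_points (col' j @` (K `&` [set a | dotv l a = c])))
    (col' j f).
  apply: IH => // l'.
  have [a [Ka la] h] := Kc (\row_i if unlift j i is Some i' then l' ord0 i' else 0).
  exists (col' j a); first by exists a.
  have E x : dotv (\row_i if unlift j i is Some i' then l' ord0 i' else 0) x =
      dotv l' (col' j x).
    rewrite (dotv_col' _ _ j) mxE unlift_none mul0r add0r; congr dotv.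
    by apply/rowP => i; rewrite !mxE liftK.
  by rewrite -!E.
rewrite -{2}(@col'_lift n l c j f)//; move: (col' j f).
apply: convex_hull_min => /=; last first.
  move=> x y t hx hy t0 t1; rewrite hyperplane_lift_conv.
  exact: convex_hull_convex.
move=> _ [[a [Ka la] <-] ext]; rewrite col'_lift//; apply: sub_convex_hull.
split=> // y z t Ky Kz t0 t1 ayz.
have h : t * dotv l y + (1 - t) * dotv l z = c.
  by rewrite -!dotvZr -dotvDr -ayz.
have yc : dotv l y = c by have := lf _ Ky; have := lf _ Kz; nra.
have zc : dotv l z = c by have := lf _ Ky; have := lf _ Kz; nra.
have [||//|//||Ey Ez] := ext (col' j y) (col' j z) t.
- by exists y.
- by exists z.
- by rewrite ayz; apply/rowP => i; rewrite !mxE.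
- by rewrite -(col'_lift lj yc) Ey -(col'_lift lj zc) Ez col'_lift.
Qed.

(** A point is between the two supported points found by leaving it along a line
    in both directions. *)
Theorem dominated_convex_hull n (K : set 'rV[R]_n) f :
  compact K -> dominated K f -> convex_hull (extreme_points K) f.
Proof.
elim: n K f => [|n IH] K f cK Kf.
  have [a Ka _] := Kf 0.
  apply: sub_convex_hull; split; first by rewrite (thinmx0 f) -(thinmx0 a).
  by move=> y z *; split; apply/rowP => -[].
pose v : 'rV[R]_n.+1 := delta_mx ord0 ord0.
have v0 : v != 0.
  by apply/rV0Pn; exists ord0; rewrite mxE !eqxx oner_neq0.
have [t [l [t0 l0 Kt lt]]] := dominated_exit cK Kf v0.
have Nv0 : - v != 0 by rewrite oppr_eq0.
have [s [l' [s0 l'0 Ks ls]]] := dominated_exit cK Kf Nv0.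
have ht := dominated_supported IH cK Kt l0 lt.
have hs := dominated_supported IH cK Ks l'0 ls.
have [t00|tn0] := eqVneq t 0; first by move: ht; rewrite t00 scale0r addr0.
have [s00|sn0] := eqVneq s 0; first by move: hs; rewrite s00 scale0r addr0.
have {}t0 : 0 < t by rewrite lt_def tn0.
have {}s0 : 0 < s by rewrite lt_def sn0.
have st0 : 0 < s + t by rewrite addr_gt0.
have -> : f = (s / (s + t)) *: (f + t *: v) +
    (1 - s / (s + t)) *: (f + s *: (- v)).
  by apply/rowP => i; rewrite !mxE; field; rewrite gt_eqF.
apply: convex_hull_convex => //; first by rewrite divr_gt0.
by rewrite ltr_pdivrMr// mul1r ltrDl.
Qed.

End KreinMilman.

(** * Real and imaginary parts of scalars *)

Section ScalarDefs.
Context {R : realType} {s : scalar_kind}.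
Local Notation F := (scalar_field R s).

Definition scalar_im : F -> R :=
  match s return scalar_field R s -> R with
  | RealScalars => fun=> 0
  | ComplexScalars => fun z => complex.Im z
  end.

(** Over the reals the second coordinate is dropped, so that a pair of real
    coordinates always gives a scalar and every scalar arises in this way. *)
Definition scalar_mk (r t : R) : F :=
  match s return scalar_field R s with
  | RealScalars => r
  | ComplexScalars => Complex r t
  end.

End ScalarDefs.

Section ScalarTheory.
Context {R : realType} {s : scalar_kind}.
Local Notation F := (scalar_field R s).
Implicit Types (a b : F) (r t : R).

Lemma scalar_eq a b :
  scalar_re a = scalar_re b -> scalar_im a = scalar_im b -> a = b.
Proof. by case: s a b => [//|[a a'] [b b']] /= -> ->. Qed.

Lemma scalar_imD a b : scalar_im (a + b) = scalar_im a + scalar_im b.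
Proof. by case: s a b => [a b|[a a'] [b b']] //=; rewrite addr0. Qed.

Lemma scalar_reM a b : scalar_re (a * b) =
  scalar_re a * scalar_re b - scalar_im a * scalar_im b.
Proof. by case: s a b => [a b|[a a'] [b b']] //=; rewrite mul0r subr0. Qed.

Lemma scalar_imM a b : scalar_im (a * b) =
  scalar_re a * scalar_im b + scalar_im a * scalar_re b.
Proof. by case: s a b => [a b|[a a'] [b b']] //=; rewrite mulr0 mul0r addr0. Qed.

Lemma scalar_re_real r : scalar_re (scalar_of_real r : F) = r.
Proof. by case: s. Qed.

Lemma scalar_im_real r : scalar_im (scalar_of_real r : F) = 0.
Proof. by case: s. Qed.

Lemma scalar_re_mk r t : scalar_re (scalar_mk r t : F) = r.
Proof. by case: s. Qed.

Lemma scalar_mkK a : scalar_mk (scalar_re a) (scalar_im a) = a.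
Proof. by case: s a => [//|[]]. Qed.

(** The real inner product of the coordinate pairs is the real part of a scalar
    product. *)
Lemma scalar_mk_pair r t a : scalar_re (scalar_mk r (- t) * a) =
  r * scalar_re a + t * scalar_im a.
Proof.
by case: s a => [a|[a b]] /=; rewrite ?mulr0 ?addr0// mulNr opprK.
Qed.

Lemma scalar_re_sum (I : Type) (l : seq I) (P : pred I) (g : I -> F) :
  scalar_re (\sum_(i <- l | P i) g i) = \sum_(i <- l | P i) scalar_re (g i).
Proof.
by apply: (big_morph _ (@scalar_reD R s)); case: s.
Qed.

Lemma scalar_im_sum (I : Type) (l : seq I) (P : pred I) (g : I -> F) :
  scalar_im (\sum_(i <- l | P i) g i) = \sum_(i <- l | P i) scalar_im (g i).
Proof.
by apply: (big_morph _ scalar_imD); case: s.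
Qed.

Lemma scalar_of_realD r t :
  scalar_of_real (r + t) = scalar_of_real r + scalar_of_real t :> F.
Proof.
by apply: scalar_eq;
  rewrite ?scalar_reD ?scalar_imD ?scalar_re_real ?scalar_im_real ?addr0.
Qed.

Lemma scalar_of_realM r t :
  scalar_of_real (r * t) = scalar_of_real r * scalar_of_real t :> F.
Proof.
apply: scalar_eq; rewrite ?scalar_reM ?scalar_imM ?scalar_re_real
  ?scalar_im_real; ring.
Qed.

Lemma scalar_of_real0 : scalar_of_real 0 = 0 :> F.
Proof. by case: s. Qed.

Lemma scalar_re0 : scalar_re (0 : F) = 0.
Proof. by rewrite -scalar_of_real0 scalar_re_real. Qed.

Lemma scalar_of_real1 : scalar_of_real 1 = 1 :> F.
Proof. by case: s. Qed.

Lemma scalar_re1 : scalar_re (1 : F) = 1.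
Proof. by rewrite -scalar_of_real1 scalar_re_real. Qed.

Lemma scalar_of_realB r t :
  scalar_of_real (r - t) = scalar_of_real r - scalar_of_real t :> F.
Proof. by apply/eqP; rewrite eq_sym subr_eq -scalar_of_realD subrK. Qed.

Lemma scalar_of_real_sum (I : Type) (l : seq I) (P : pred I) (g : I -> R) :
  scalar_of_real (\sum_(i <- l | P i) g i) =
  \sum_(i <- l | P i) scalar_of_real (g i) :> F.
Proof.
by apply: (big_morph _ scalar_of_realD); exact: scalar_of_real0.
Qed.

(** In the order of the complex numbers, positive elements are real. *)
Lemma convex_weight_real a : 0 < a -> a < 1 ->
  exists t, [/\ 0 < t, t < 1 & a = scalar_of_real t].
Proof.
move: a; case: s => [a a0 a1|[a b]]; first by exists a.
rewrite !ltcE /= => /andP[/eqP b0 a0] /andP[_ a1].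
by exists a; split => //=; rewrite b0.
Qed.

Lemma scalar_of_real_gt0 r : (0 < scalar_of_real r :> F) = (0 < r).
Proof. by case: s => //=; rewrite ltcE /= eqxx. Qed.

Lemma scalar_of_real_lt1 r : (scalar_of_real r < 1 :> F) = (r < 1).
Proof. by case: s => //=; rewrite ltcE /= eqxx. Qed.

Lemma scalar_absE a :
  scalar_abs a = Num.sqrt (scalar_re a ^+ 2 + scalar_im a ^+ 2).
Proof.
rewrite /scalar_abs; case: s a => [a|[a b]] //=.
by rewrite expr0n addr0 sqrtr_sqr.
Qed.

Lemma scalar_absM a b : scalar_abs (a * b) = scalar_abs a * scalar_abs b.
Proof. by rewrite /scalar_abs normrM scalar_re_normM. Qed.

Lemma scalar_absD a b : scalar_abs (a + b) <= scalar_abs a + scalar_abs b.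
Proof. by rewrite /scalar_abs -scalar_reD scalar_re_le// ler_normD. Qed.

Lemma scalar_abs_real r : scalar_abs (scalar_of_real r : F) = `|r|.
Proof.
by rewrite scalar_absE scalar_re_real scalar_im_real expr0n addr0 sqrtr_sqr.
Qed.

Lemma scalar_abs0 : scalar_abs (0 : F) = 0.
Proof. by rewrite -scalar_of_real0 scalar_abs_real normr0. Qed.

Lemma scalar_abs1 : scalar_abs (1 : F) = 1.
Proof. by rewrite -scalar_of_real1 scalar_abs_real normr1. Qed.

Lemma scalar_abs_sum (I : Type) (l : seq I) (P : pred I) (g : I -> F) :
  scalar_abs (\sum_(i <- l | P i) g i) <= \sum_(i <- l | P i) scalar_abs (g i).
Proof.
elim/big_rec2 : _ => [|i x y _ h]; first by rewrite scalar_abs0.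
by rewrite (le_trans (scalar_absD _ _))// lerD2l.
Qed.

Lemma scalar_re_le_abs a : `|scalar_re a| <= scalar_abs a.
Proof.
by rewrite scalar_absE -sqrtr_sqr ler_wsqrtr// lerDl sqr_ge0.
Qed.

Lemma scalar_im_le_abs a : `|scalar_im a| <= scalar_abs a.
Proof.
by rewrite scalar_absE -sqrtr_sqr ler_wsqrtr// lerDr sqr_ge0.
Qed.

Lemma scalar_re_eq_abs a :
  scalar_abs a <= scalar_re a -> a = scalar_of_real (scalar_re a).
Proof.
move=> h; apply: scalar_eq; rewrite ?scalar_re_real ?scalar_im_real//.
have r0 : 0 <= scalar_re a := le_trans (scalar_abs_ge0 a) h.
move: h; rewrite scalar_absE -[leRHS]ger0_norm// -sqrtr_sqr.
rewrite ler_sqrt ?sqr_ge0// gerDl => h.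
by apply/eqP; rewrite -sqrf_eq0 eq_le h sqr_ge0.
Qed.

Lemma scalar_abs_eq0 a : scalar_abs a = 0 -> a = 0.
Proof.
move=> a0; rewrite (@scalar_re_eq_abs a); last first.
  by rewrite a0; have := scalar_re_le_abs a; rewrite a0 normr_le0 => /eqP->.
have := scalar_re_le_abs a.
by rewrite a0 normr_le0 => /eqP->; rewrite scalar_of_real0.
Qed.

Lemma scalar_conj_mul a :
  scalar_conj a * a = scalar_of_real (scalar_abs a ^+ 2).
Proof.
rewrite scalar_absE sqr_sqrtr ?addr_ge0 ?sqr_ge0//.
by apply: scalar_eq; case: s a => [a|[a b]]//=; ring.
Qed.

Lemma scalar_conj0 : scalar_conj (0 : F) = 0.
Proof. by case: s => //=; rewrite /conjc /= oppr0. Qed.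

Lemma scalar_abs_conj a : scalar_abs (scalar_conj a) = scalar_abs a.
Proof. by rewrite !scalar_absE; case: s a => [|[a b]]//=; rewrite sqrrN. Qed.

End ScalarTheory.

(** * Hoelder's inequality and its equality case *)

Section Hoelder.
Context {R : realType}.
Variables (p : R) (hp : 1 < p).

Definition hoelder_conj : R := p / (p - 1).
Local Notation q := hoelder_conj.

Let p0 : 0 < p. Proof. exact: lt_trans hp. Qed.
Let p10 : 0 < p - 1. Proof. by rewrite subr_gt0. Qed.

Lemma hoelder_conj_gt0 : 0 < q.
Proof. by rewrite divr_gt0. Qed.
Local Notation q0 := hoelder_conj_gt0.

Lemma hoelder_conjE : p^-1 + q^-1 = 1.
Proof. by rewrite /q; field; rewrite !gt_eqF. Qed.

Lemma hoelder_conjM : (p - 1) * q = p.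
Proof. by rewrite /q; field; rewrite gt_eqF. Qed.

(** Equality in Young's inequality: on the logarithmic scale the inequality is
    [1 + z <= expR z], which is strict away from [z = 0]. *)
Lemma young_eq a b : 0 <= a -> 0 <= b ->
  a * b = a `^ p / p + b `^ q / q -> b `^ q = a `^ p.
Proof.
have pV : 0 < p^-1 by rewrite invr_gt0.
have qV : 0 < q^-1 by rewrite invr_gt0 q0.
rewrite le_eqVlt => /predU1P[<- _|a0].
  rewrite mul0r (powR0 (lt0r_neq0 p0)) mul0r add0r => /esym/eqP.
  by rewrite mulf_eq0 (gt_eqF qV) orbF => /eqP.
rewrite le_eqVlt => /predU1P[<-|b0].
  rewrite mulr0 (powR0 (lt0r_neq0 q0)) mul0r addr0 => /esym/eqP.
  by rewrite mulf_eq0 (gt_eqF pV) orbF => /eqP ->.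
rewrite /powR !gt_eqF// -{1}(lnK a0) -{1}(lnK b0) -expRD.
set m := ln a + ln b => h.
have E : expR (p * ln a - m) / p + expR (q * ln b - m) / q = 1.
  rewrite !expRB [X in X + _]mulrAC [X in _ + X]mulrAC -mulrDl -h divff//.
  by rewrite gt_eqF ?expR_gt0.
have S : (1 + (p * ln a - m)) / p + (1 + (q * ln b - m)) / q = 1.
  have -> : (1 + (p * ln a - m)) / p + (1 + (q * ln b - m)) / q =
     (1 - m) * (p^-1 + q^-1) + m.
    by rewrite /m; field; rewrite !gt_eqF ?q0.
  by rewrite hoelder_conjE; ring.
have la := expR_ge1Dx (p * ln a - m).
have lb := expR_ge1Dx (q * ln b - m).
have [pa|/expR_gt1Dx ha] := eqVneq (p * ln a - m) 0; last by nra.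
have [qb|/expR_gt1Dx hb] := eqVneq (q * ln b - m) 0; last by nra.
by congr expR; lra.
Qed.

Variable d : nat.
Implicit Types c al : 'I_d -> R.

Definition lpnorm c : R := (\sum_i c i `^ p) `^ p^-1.

Lemma lpnorm_ge0 c : 0 <= lpnorm c.
Proof. exact: powR_ge0. Qed.

Lemma lpnormK c : lpnorm c `^ p = \sum_i c i `^ p.
Proof.
rewrite -powRrM mulVf ?gt_eqF// powRr1//.
by apply: sumr_ge0 => i _; exact: powR_ge0.
Qed.

Lemma lpnorm_eq0 c : (forall i, 0 <= c i) -> lpnorm c = 0 ->
  forall i, c i = 0.
Proof.
move=> c0 /(congr1 (fun x => x `^ p)); rewrite lpnormK (powR0 (lt0r_neq0 p0)).
move=> /eqP; rewrite psumr_eq0; last by move=> i _; exact: powR_ge0.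
move=> /allP h i; have := h i (mem_index_enum i).
by rewrite /= powR_eq0 => /andP[/eqP].
Qed.

Section Normalized.
Variables (c al : 'I_d -> R).
Hypotheses (c0 : forall i, 0 <= c i) (al0 : forall i, 0 <= al i).
Hypotheses (al1 : \sum_i al i `^ q <= 1) (N0 : 0 < lpnorm c).
Local Notation c' i := (c i / lpnorm c).

Let c'0 i : 0 <= c' i. Proof. by rewrite divr_ge0// ltW. Qed.

Let young_gap_ge0 i : 0 <= c' i `^ p / p + al i `^ q / q - c' i * al i.
Proof.
by rewrite subr_ge0 conjugate_powR//; [exact: hoelder_conj_gt0|
  exact: hoelder_conjE].
Qed.

Let sum_young_gap_le :
  \sum_i (c' i `^ p / p + al i `^ q / q - c' i * al i) <=
  1 - (\sum_i al i * c i) / lpnorm c.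
Proof.
rewrite !big_split/= sumrN -!mulr_suml.
have -> : \sum_i c' i * al i = (\sum_i al i * c i) / lpnorm c.
  by rewrite mulr_suml; apply: eq_bigr => i _; rewrite mulrC mulrA.
have -> : \sum_i c' i `^ p = 1.
  have Np : lpnorm c `^ p != 0 by rewrite gt_eqF// powR_gt0.
  apply: (mulIf Np); rewrite mul1r mulr_suml [RHS]lpnormK; apply: eq_bigr => i _.
  by rewrite -powRM// ?ltW// divfK// gt_eqF.
rewrite lerD2r mul1r -hoelder_conjE lerD2l ler_piMl//.
by rewrite invr_ge0 ltW// hoelder_conj_gt0.
Qed.

Lemma lp_hoelder_pos : \sum_i al i * c i <= lpnorm c.
Proof.
have := sumr_ge0 (index_enum 'I_d) (fun i _ => young_gap_ge0 i).
move=> /(_ xpredT) h; have := le_trans h sum_young_gap_le.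
by rewrite subr_ge0 ler_pdivrMr// mul1r.
Qed.

(** Equality in Hoelder's inequality makes every gap in Young's inequality
    vanish, since the gaps are nonnegative and add up to at most 0. *)
Lemma lp_hoelder_eq : lpnorm c <= \sum_i al i * c i ->
  forall i, al i = c' i `^ (p - 1).
Proof.
move=> h i.
have : \sum_i (c' i `^ p / p + al i `^ q / q - c' i * al i) == 0.
  rewrite eq_le sumr_ge0// andbT (le_trans sum_young_gap_le)// subr_le0.
  by rewrite ler_pdivlMr// mul1r.
rewrite psumr_eq0// => /allP/(_ i (mem_index_enum i))/=.
rewrite subr_eq0 => /eqP/esym/(young_eq (c'0 i) (al0 i)) E.
have qn0 : q != 0 by rewrite gt_eqF// hoelder_conj_gt0.
rewrite -[LHS](powRr1 (al0 i)) -(divff qn0) powRrM E -powRrM; congr powR.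
by rewrite /q; field; rewrite !gt_eqF.
Qed.

End Normalized.

Lemma lp_hoelder c al : (forall i, 0 <= c i) -> (forall i, 0 <= al i) ->
  \sum_i al i `^ q <= 1 -> \sum_i al i * c i <= lpnorm c.
Proof.
move=> c0 al0 al1.
have := lpnorm_ge0 c; rewrite le_eqVlt => /predU1P[N0|]; last first.
  exact: lp_hoelder_pos.
rewrite -N0 big1// => i _.
by rewrite (lpnorm_eq0 c0 (esym N0)) mulr0.
Qed.

End Hoelder.

Section ScalarHoelder.
Context {R : realType} {s : scalar_kind}.
Local Notation F := (scalar_field R s).
Variables (p : R) (hp : 1 < p) (d : nat).
Local Notation q := (hoelder_conj p).
Implicit Types c al : 'I_d -> F.

Let p0 : 0 < p. Proof. exact: lt_trans hp. Qed.
Let p10 : 0 < p - 1. Proof. by rewrite subr_gt0. Qed.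

Definition abs_family c : 'I_d -> R := fun i => scalar_abs (c i).

Lemma scalar_hoelder c al : \sum_i scalar_abs (al i) `^ q <= 1 ->
  scalar_abs (\sum_i al i * c i) <= lpnorm p (abs_family c).
Proof.
move=> al1; apply: (le_trans (scalar_abs_sum _ _ _)).
under eq_bigr do rewrite scalar_absM.
by apply: (@lp_hoelder R p hp d (abs_family c) (abs_family al)) => // i;
  exact: scalar_abs_ge0.
Qed.

Lemma scalar_abs_conj_powR (a : F) :
  scalar_abs (conj_powR p a) = scalar_abs a `^ (p - 1).
Proof.
rewrite /conj_powR scalar_absM scalar_abs_conj scalar_abs_real.
rewrite ger0_norm ?powR_ge0//.
have := scalar_abs_ge0 a; rewrite le_eqVlt => /predU1P[<-|a0].
  by rewrite mul0r powR0// gt_eqF.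
rewrite -{1}(powRr1 (ltW a0)) -powRD; last by rewrite (gt_eqF a0) implybT.
by congr powR; ring.
Qed.

Lemma conj_powR_mul (a : F) :
  conj_powR p a * a = scalar_of_real (scalar_abs a `^ p).
Proof.
rewrite /conj_powR mulrAC scalar_conj_mul -scalar_of_realM; congr scalar_of_real.
have := scalar_abs_ge0 a; rewrite le_eqVlt => /predU1P[<-|a0].
  by rewrite expr0n mul0r powR0// gt_eqF.
rewrite -powR_mulrn ?ltW// -powRD; last by rewrite (gt_eqF a0) implybT.
by congr powR; ring.
Qed.

(** With [N] the [l^p] norm of [c], the vector of [l^q] that norms [c]. *)
Definition norming_weights (N : R) c : 'I_d -> F :=
  fun i => scalar_of_real (N `^ (p - 1))^-1 * conj_powR p (c i).

Section Norming.
Variable c : 'I_d -> F.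
Local Notation N := (lpnorm p (abs_family c)).
Hypothesis N0 : 0 < N.

Lemma norming_weights_norm :
  \sum_i scalar_abs (norming_weights N c i) `^ q = 1.
Proof.
have Np : N `^ p != 0 by rewrite gt_eqF// powR_gt0.
have E i : scalar_abs (norming_weights N c i) `^ q * N `^ p =
    scalar_abs (c i) `^ p.
  rewrite /norming_weights scalar_absM scalar_abs_conj_powR scalar_abs_real.
  rewrite ger0_norm ?invr_ge0 ?powR_ge0//.
  have P x : x `^ p = (x `^ (p - 1)) `^ q by rewrite -powRrM hoelder_conjM.
  rewrite (P N) (P (scalar_abs _)) -powRM ?mulr_ge0 ?invr_ge0 ?powR_ge0//.
  by rewrite mulrAC mulVf ?mul1r// gt_eqF// powR_gt0.
apply: (mulIf Np); rewrite mul1r mulr_suml [RHS](lpnormK hp).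
by apply: eq_bigr => i _; exact: E.
Qed.

Lemma norming_weights_pair :
  \sum_i norming_weights N c i * c i = scalar_of_real N.
Proof.
under eq_bigr => i _ do rewrite -mulrA conj_powR_mul.
rewrite -mulr_sumr -scalar_of_real_sum -scalar_of_realM; congr scalar_of_real.
have -> : \sum_i scalar_abs (c i) `^ p = N `^ (p - 1) * N.
  rewrite -[X in _ * X](powRr1 (ltW N0)) -powRD.
    by rewrite subrK (lpnormK hp).
  by rewrite (gt_eqF N0) implybT.
by rewrite mulKf// gt_eqF// powR_gt0.
Qed.

(** Attaining the norm of [c] forces equality in Hoelder's inequality for the
    moduli, which fixes the moduli of the weights, and equality between each
    product and its modulus, which fixes their arguments. *)
Lemma norming_weights_uniq al : \sum_i scalar_abs (al i) `^ q <= 1 ->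
  N <= scalar_re (\sum_i al i * c i) -> al = norming_weights N c.
Proof.
move=> al1 h.
have le1 : scalar_re (\sum_i al i * c i) <= \sum_i abs_family al i * abs_family c i.
  rewrite scalar_re_sum; apply: ler_sum => i _; rewrite -scalar_absM.
  exact: le_trans (ler_norm _) (scalar_re_le_abs _).
have c0 i : 0 <= abs_family c i := scalar_abs_ge0 _.
have al0 i : 0 <= abs_family al i := scalar_abs_ge0 _.
have le2 := lp_hoelder hp c0 al0 al1.
have alE := lp_hoelder_eq hp c0 al0 al1 N0 (le_trans h le1).
have gap i : scalar_abs (al i * c i) <= scalar_re (al i * c i).
  have : \sum_j (scalar_abs (al j * c j) - scalar_re (al j * c j)) == 0.
    rewrite eq_le sumr_ge0 ?andbT; last first.
      move=> j _; rewrite subr_ge0.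
      exact: le_trans (ler_norm _) (scalar_re_le_abs _).
    rewrite big_split/= sumrN subr_le0 -[leRHS]scalar_re_sum.
    rewrite (eq_bigr (fun j => abs_family al j * abs_family c j)).
      exact: le_trans le2 h.
    by move=> j _; rewrite scalar_absM.
  rewrite psumr_eq0; last first.
    move=> j _; rewrite subr_ge0.
    exact: le_trans (ler_norm _) (scalar_re_le_abs _).
  by move=> /allP/(_ i (mem_index_enum i))/=; rewrite subr_eq0 => /eqP->.
apply/funext => i.
have [ci0|ci0] := eqVneq (c i) 0.
  have -> : al i = 0.
    apply: scalar_abs_eq0; rewrite -/(abs_family al i) alE /abs_family ci0.
    by rewrite scalar_abs0 mul0r powR0// gt_eqF.
  rewrite /norming_weights ci0 /conj_powR.
  by rewrite (_ : scalar_conj 0 = 0) ?mul0r ?mulr0//; exact: scalar_conj0.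
apply: (mulIf ci0); rewrite /norming_weights -mulrA conj_powR_mul.
rewrite (scalar_re_eq_abs (gap i)) -scalar_of_realM; congr scalar_of_real.
have -> : scalar_re (al i * c i) = scalar_abs (al i) * scalar_abs (c i).
  rewrite -scalar_absM; apply: le_anti; rewrite gap andbT.
  exact: le_trans (ler_norm _) (scalar_re_le_abs _).
have Np : N `^ (p - 1) != 0 by rewrite gt_eqF// powR_gt0.
have ci1 : 0 < scalar_abs (c i).
  by rewrite lt_def scalar_abs_ge0 andbT; apply: contra_neq ci0 => /scalar_abs_eq0.
rewrite -/(abs_family al i) alE; apply: (mulfI Np).
rewrite mulVKf// mulrA -powRM ?divr_ge0 ?lpnorm_ge0// [N * _]mulrC divfK ?gt_eqF//.
rewrite -[X in _ * X](powRr1 (c0 i)) -powRD; last by rewrite (gt_eqF ci1) implybT.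
by rewrite subrK.
Qed.

End Norming.
End ScalarHoelder.

(** * The Krein-Milman theorem in a finite-dimensional dual space *)

Section LinearMaps.
Context {K : numFieldType} {U V : lmodType K} (f : U -> V) (lf : linear f).

Let g : {linear U -> V} := HB.pack f (GRing.isLinear.Build _ _ _ _ f lf).

Lemma linear_fun0 : f 0 = 0. Proof. exact: (linear0 g). Qed.
Lemma linear_funD u v : f (u + v) = f u + f v. Proof. exact: (linearD g). Qed.
Lemma linear_funZ a u : f (a *: u) = a *: f u.
Proof. by rewrite -[a *: u]addr0 lf linear_fun0 addr0. Qed.
Lemma linear_fun_sum (I : Type) (r : seq I) (P : pred I) (c : I -> K)
    (e : I -> U) : f (\sum_(i <- r | P i) c i *: e i) =
  \sum_(i <- r | P i) c i *: f (e i).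
Proof.
rewrite (big_morph f linear_funD linear_fun0).
by apply: eq_bigr => i _; exact: linear_funZ.
Qed.

End LinearMaps.

Section DualKreinMilman.
Context {R : realType} {s : scalar_kind}.
Local Notation F := (scalar_field R s).
Context {V : lmodType F} {J : finType} (b : J -> V).

(** Values on a spanning family identify linear functionals with real vectors,
    which makes convexity over the scalar field a matter of real vectors. *)
Definition real_coords (g : V -> F^o) : 'rV[R]_(#|J| + #|J|) :=
  row_mx (\row_j scalar_re (g (b (enum_val j)) : F))
         (\row_j scalar_im (g (b (enum_val j)) : F)).

Lemma real_coords_comb t (g h : V -> F^o) :
  real_coords ((scalar_of_real t : F) *: g + (1 - scalar_of_real t : F) *: h) =
  t *: real_coords g + (1 - t) *: real_coords h.
Proof.
rewrite -scalar_of_real1 -scalar_of_realB.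
rewrite /real_coords !scale_row_mx add_row_mx; congr row_mx; apply/rowP => j;
  rewrite !mxE; [rewrite scalar_reD|rewrite scalar_imD];
  by rewrite ?(scalar_reM, scalar_imM) !(scalar_re_real, scalar_im_real) !mul0r
    ?subr0 ?addr0.
Qed.

Lemma linear_comb (a c : F) (g h : V -> F^o) :
  linear g -> linear h -> linear (a *: g + c *: h).
Proof.
move=> lg lh z u v.
change (a *: g (z *: u + v) + c *: h (z *: u + v) =
  z *: (a *: g u + c *: h u) + (a *: g v + c *: h v)).
by rewrite lg lh !scalerDr !scalerA ![_ * z]mulrC addrACA.
Qed.

Hypothesis b_span : forall v, exists c : J -> F, v = \sum_j c j *: b j.

Lemma real_coords_inj (g h : V -> F^o) : linear g -> linear h ->
  real_coords g = real_coords h -> g = h.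
Proof.
move=> lg lh /eq_row_mx[/rowP er /rowP ei]; apply/funext => v.
have [c ->] := b_span v; rewrite !linear_fun_sum//; apply: eq_bigr => j _.
congr (_ *: _); apply: scalar_eq.
  by have := er (enum_rank j); rewrite !mxE enum_rankK.
by have := ei (enum_rank j); rewrite !mxE enum_rankK.
Qed.

(** Conjugating the coefficients of a functional on the coordinates gives the
    combination of the spanning family at which to evaluate. *)
Lemma real_coords_dual l : exists v, forall g : V -> F^o, linear g ->
  dotv l (real_coords g) = scalar_re (g v : F).
Proof.
exists (\sum_j scalar_mk (l ord0 (lshift _ (enum_rank j)))
   (- l ord0 (rshift _ (enum_rank j))) *: b j) => g lg.
rewrite linear_fun_sum// scalar_re_sum /dotv big_split_ord/= -big_split/=.
rewrite (reindex (@enum_rank J))/=; last first.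
  by apply: onW_bij; exact: enum_rank_bij.
apply: eq_bigr => j _; rewrite [RHS]scalar_mk_pair row_mxEl row_mxEr !mxE.
by rewrite enum_rankK.
Qed.

(** The Krein-Milman theorem in the dual of a finite-dimensional space. Weak-star
    compactness of [K] is tested on the spanning family [b], and the last
    hypothesis puts [f] in the weak-star closed convex hull of [K]. *)
Theorem dual_krein_milman (K : set (V -> F^o)) f :
  (forall g, K g -> linear g) -> linear f -> compact (real_coords @` K) ->
  (forall v r, (forall g, K g -> scalar_re (g v : F) <= r) ->
    scalar_re (f v : F) <= r) ->
  convex_hull (extreme_points K) f.
Proof.
move=> lK lf cK Kf.
have : convex_hull (extreme_points (real_coords @` K)) (real_coords f).
  apply: dominated_convex_hull => // l.
  have K0 : real_coords @` K !=set0.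
    apply: contrapT => K0; have : scalar_re (f 0 : F) <= -1.
      by apply: Kf => g Kg; case: K0; exists (real_coords g), g.
    by rewrite linear_fun0// scalar_re0 ler0N1.
  have [v lv] := real_coords_dual l.
  have [_ [g Kg <-] gmax] := dotv_max l cK K0.
  exists (real_coords g); first by exists g.
  rewrite (lv f lf); apply: Kf => h Kh; rewrite -(lv h (lK _ Kh)).
  by apply: gmax; exists h.
suff : convex_hull (extreme_points (real_coords @` K)) `<=`
    [set y | exists g, [/\ convex_hull (extreme_points K) g, linear g &
      real_coords g = y]].
  by move=> /[apply] -[g [Kg lg /(real_coords_inj lg lf)<-]].
apply: convex_hull_min =>
  [_ [[g Kg <-] ext]|_ _ t [g [Kg lg <-]] [h [Kh lh <-]] t0 t1].
  exists g; split => //; last exact: lK.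
  apply: sub_convex_hull; split => // y z t Ky Kz t0 t1 gyz.
  have [r [r0 r1 tr]] := convex_weight_real t0 t1.
  have [||//|//||ey ez] := ext (real_coords y) (real_coords z) r.
  - by exists y.
  - by exists z.
  - by rewrite gyz tr real_coords_comb.
  - by split; apply: real_coords_inj => //; exact: lK.
exists ((scalar_of_real t : F) *: g + (1 - scalar_of_real t : F) *: h); split.
- apply: convex_hull_convex => //.
    by rewrite scalar_of_real_gt0.
  by rewrite scalar_of_real_lt1.
- exact: linear_comb.
- exact: real_coords_comb.
Qed.

End DualKreinMilman.

Section Face.
Context {R : realType} {s : scalar_kind}.
Local Notation F := (scalar_field R s).
Context {V : lmodType F}.

(** The maximum of an affine function over a convex combination is attained only
    if all the points with positive weight attain it. *)
Lemma convex_hull_face (A : set V) (l : V -> R) (w : R) v :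
  (forall (t : R) x y,
    l ((scalar_of_real t : F) *: x + (1 - scalar_of_real t : F) *: y) =
    t * l x + (1 - t) * l y) ->
  (forall a, A a -> l a <= w) -> convex_hull A v -> w <= l v ->
  convex_hull (A `&` [set a | w <= l a]) v.
Proof.
move=> ll Aw hv.
suff [_ h] : l v <= w /\
  (w <= l v -> convex_hull (A `&` [set a | w <= l a]) v) by [].
move: v hv; apply: (@convex_hull_min _ _ _ [set v | l v <= w /\
  (w <= l v -> convex_hull (A `&` [set a | w <= l a]) v)]).
  by move=> a Aa; split; [exact: Aw|move=> wa; exact: sub_convex_hull].
move=> x y t [xw hx] [yw hy] t0 t1.
have [r [r0 r1 tr]] := convex_weight_real t0 t1.
have E : l (t *: x + (1 - t) *: y) = r * l x + (1 - r) * l y by rewrite tr ll.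
rewrite /= E; split; first by nra.
move=> wl; apply: convex_hull_convex => //; [apply: hx|apply: hy]; nra.
Qed.

End Face.

(** * Coordinates in a finite-dimensional normed space *)

Section Basis.
Context {R : realType} {s : scalar_kind}.
Local Notation K := (scalar_field R s).
Context {V : lmodType K}.

(** A spanning family of minimal size is free, and then its coordinate
    functions are linear. *)
Lemma finite_dimensional_coords (hV : finite_dimensional V) :
  exists (n : nat) (e : 'I_n -> V) (k : 'I_n -> V -> K^o),
  [/\ forall i, linear (k i), forall v, v = \sum_i k i v *: e i &
      forall c : 'I_n -> K, \sum_i c i *: e i = 0 -> forall i, c i = 0].
Proof.
pose spans n := exists e : 'I_n -> V, forall v, exists c, v = \sum_i c i *: e i.
have ex_spans : exists n, `[< spans n >].
  by have [n [e he]] := hV; exists n; apply/asboolP; exists e.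
case: (ex_minnP ex_spans) => n /asboolP[e he] nmin.
(* an element of the family with a nonzero coefficient in a relation could be
     dropped, against minimality *)
have free c : \sum_i c i *: e i = 0 -> forall i, c i = 0.
  move=> ce0 j; apply/eqP/negPn/negP => cj.
  case: n e he nmin c j ce0 cj => [|n] e he nmin c j ce0 cj; first by case: j cj.
  suff /asboolP/nmin : spans n by rewrite ltnn.
  exists (fun i => e (lift j i)) => v; have [a ->] := he v.
  move: ce0; rewrite (bigD1_ord j)//= => /eqP; rewrite addr_eq0 => /eqP ce0.
  exists (fun i => a (lift j i) - a j / c j * c (lift j i)).
  rewrite (bigD1_ord j)//= -[e j](scalerK cj) ce0.
  rewrite scalerN scalerN scalerA scaler_sumr.
  rewrite addrC -sumrB; apply: eq_bigr => i _.
  by rewrite scalerA -scalerBl.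
have [k hk] := choice he.
exists n, e, (fun i v => k v i); split => // i a u v.
apply/eqP; rewrite -subr_eq0; apply/eqP.
apply: (free (fun i => k (a *: u + v) i - (a * k u i + k v i))).
rewrite (eq_bigr (fun i => k (a *: u + v) i *: e i -
    (a *: (k u i *: e i) + k v i *: e i))); last first.
  by move=> j _; rewrite scalerBl scalerDl scalerA.
by rewrite sumrB big_split/= -scaler_sumr -!hk subrr.
Qed.

End Basis.

Section VectorNorm.
Context {R : realType} {s : scalar_kind} {X : normedModType (scalar_field R s)}.
Implicit Types x y : X.

Lemma vnormE x : vnorm x = scalar_abs `|x|.
Proof. by rewrite /scalar_abs normr_id. Qed.

Lemma vnorm_ge0 x : 0 <= vnorm x.
Proof. by rewrite vnormE scalar_abs_ge0. Qed.

Lemma vnorm_eq0 x : vnorm x = 0 -> x = 0.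
Proof. by rewrite vnormE => /scalar_abs_eq0/normr0_eq0. Qed.

Lemma vnormN x : vnorm (- x) = vnorm x.
Proof. by rewrite /vnorm normrN. Qed.

Lemma vnorm_sum (I : Type) (r : seq I) (P : pred I) (g : I -> X) :
  vnorm (\sum_(i <- r | P i) g i) <= \sum_(i <- r | P i) vnorm (g i).
Proof.
elim/big_rec2 : _ => [|i x y _ h]; first by rewrite vnorm0.
by rewrite (le_trans (vnormD _ _))// lerD2l.
Qed.

Lemma vnorm_dist x y : `|vnorm x - vnorm y| <= vnorm (x - y).
Proof.
rewrite ler_norml; apply/andP; split.
  rewrite lerNl opprB lerBlDr -{1}(subrK x y) -[x - y]opprB vnormN.
  exact: vnormD.
by rewrite lerBlDr -{1}(subrK y x) vnormD.
Qed.

End VectorNorm.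

Section ScalarContinuity.
Context {R : realType} {s : scalar_kind}.
Local Notation F := (scalar_field R s).
Context {T : topologicalType}.
Implicit Types g h : T -> F.

Definition scalar_continuous g :=
  continuous (fun x => scalar_re (g x)) /\
  continuous (fun x => scalar_im (g x)).

Lemma scalar_continuous_cst (a : F) : scalar_continuous (fun=> a).
Proof. by split=> x; exact: cst_continuous. Qed.

Lemma scalar_continuousM g h : scalar_continuous g -> scalar_continuous h ->
  scalar_continuous (fun x => g x * h x).
Proof.
move=> [gr gi] [hr hi]; split=> x; rewrite /continuous_at.
  under eq_fun do rewrite scalar_reM; rewrite scalar_reM.
  by apply: cvgB; apply: cvgM; [exact: gr|exact: hr|exact: gi|exact: hi].
under eq_fun do rewrite scalar_imM; rewrite scalar_imM.
by apply: cvgD; apply: cvgM; [exact: gr|exact: hi|exact: gi|exact: hr].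
Qed.

Lemma scalar_continuous_sum (I : Type) (r : seq I) (P : pred I)
    (g : I -> T -> F) : (forall i, P i -> scalar_continuous (g i)) ->
  scalar_continuous (fun x => \sum_(i <- r | P i) g i x).
Proof.
move=> cg; split.
  under eq_fun do rewrite scalar_re_sum.
  by apply: sum_continuous => i Pi; exact: (cg i Pi).1.
under eq_fun do rewrite scalar_im_sum.
by apply: sum_continuous => i Pi; exact: (cg i Pi).2.
Qed.

Lemma scalar_continuousB g h : scalar_continuous g -> scalar_continuous h ->
  scalar_continuous (fun x => g x - h x).
Proof.
move=> cg ch; rewrite (_ : (fun _ => _) = fun x => g x + -1 * h x); last first.
  by apply/funext => x; rewrite mulN1r.
have [gr gi] := cg.
have [hr hi] : scalar_continuous (fun x => -1 * h x).
  by apply: scalar_continuousM => //; exact: scalar_continuous_cst.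
split=> x; rewrite /continuous_at.
  under eq_fun do rewrite scalar_reD; rewrite scalar_reD.
  by apply: cvgD; [exact: gr|exact: hr].
under eq_fun do rewrite scalar_imD; rewrite scalar_imD.
by apply: cvgD; [exact: gi|exact: hi].
Qed.

Lemma scalar_abs_continuous g : scalar_continuous g ->
  continuous (fun x => scalar_abs (g x)).
Proof.
move=> [gr gi] x; rewrite /continuous_at.
under eq_fun do rewrite scalar_absE; rewrite scalar_absE.
apply: (@continuous_comp _ _ _
  (fun x => scalar_re (g x) ^+ 2 + scalar_im (g x) ^+ 2) Num.sqrt); last exact: sqrt_continuous.
by apply: cvgD; apply: cvgM; [exact: gr|exact: gr|exact: gi|exact: gi].
Qed.

Lemma vnorm_comb_continuous (X : normedModType F) n (e : 'I_n -> X)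
    (g : 'I_n -> T -> F) : (forall i, scalar_continuous (g i)) ->
  continuous (fun x => vnorm (\sum_i g i x *: e i)).
Proof.
move=> cg x0.
pose h x := \sum_i scalar_abs (g i x - g i x0) * vnorm (e i).
have ch : continuous h.
  apply: sum_continuous => i _ x.
  apply: cvgM; last exact: cvg_cst.
  apply: (@scalar_abs_continuous (fun x => g i x - g i x0)).
  by apply: scalar_continuousB => //; exact: scalar_continuous_cst.
have h0 : h x0 = 0.
  by rewrite /h big1// => i _; rewrite subrr scalar_abs0 mul0r.
apply/cvgrPdist_lt => eps eps0.
have := ch x0; rewrite /continuous_at h0 => /cvgr_lt/(_ eps eps0).
apply: filterS => x; apply: le_lt_trans.
apply: (le_trans (vnorm_dist _ _)); rewrite -sumrB.
apply: (le_trans (vnorm_sum _ _ _)); apply: ler_sum => i _.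
by rewrite -scalerBl vnormZ -[g i x0 - _]opprB /scalar_abs normrN.
Qed.

End ScalarContinuity.

Section Decode.
Context {R : realType} {s : scalar_kind}.
Local Notation F := (scalar_field R s).

(** Scalar families are parametrized by real vectors, so that compactness is only
    needed in real coordinate spaces. *)
Definition decode n (p : 'rV[R]_(n + n)) (i : 'I_n) : F :=
  scalar_mk (p ord0 (lshift n i)) (p ord0 (rshift n i)).

Definition encode n (c : 'I_n -> F) : 'rV[R]_(n + n) :=
  row_mx (\row_i scalar_re (c i)) (\row_i scalar_im (c i)).

Lemma encodeK n (c : 'I_n -> F) : decode (encode c) = c.
Proof.
by apply/funext => i; rewrite /decode row_mxEl row_mxEr !mxE scalar_mkK.
Qed.

Lemma encode_norm n (c : 'I_n -> F) (r : R) : 0 <= r ->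
  (forall i, scalar_abs (c i) <= r) -> `|encode c| <= r.
Proof.
move=> r0 cr; rewrite [leLHS]/Num.norm/= mx_normrE.
apply/bigmax_leP; split => // -[i j] _ /=; rewrite (ord1 i).
rewrite -(splitK j); case: (fintype.split j) => k /=.
  rewrite row_mxEl mxE; exact: le_trans (scalar_re_le_abs _) (cr k).
rewrite row_mxEr mxE; exact: le_trans (scalar_im_le_abs _) (cr k).
Qed.

Lemma decode_continuous n i : scalar_continuous (fun p => @decode n p i).
Proof.
split.
  under eq_fun do rewrite scalar_re_mk.
  by move=> x; exact: coord_continuous.
rewrite /decode /scalar_im /scalar_mk; case: s => x; first exact: cst_continuous.
exact: coord_continuous.
Qed.

(** Equivalence of norms: the norm of a combination of the basis is continuous in
    the coefficients, hence has a positive minimum over coefficients whose moduli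
    add up to 1. *)
Lemma coords_bounded (X : normedModType F) n (e : 'I_n -> X)
    (k : 'I_n -> X -> F^o) :
  (forall v, v = \sum_i k i v *: e i) ->
  (forall c : 'I_n -> F, \sum_i c i *: e i = 0 -> forall i, c i = 0) ->
  exists2 M : R, 0 <= M & forall i v, scalar_abs (k i v : F) <= M * vnorm v.
Proof.
move=> kE free.
pose S := [set p : 'rV[R]_(n + n) | `|p| <= 1 /\
  \sum_i scalar_abs (decode p i) = 1].
pose G (p : 'rV[R]_(n + n)) := vnorm (\sum_i decode p i *: e i).
have cG : continuous G.
  by apply: vnorm_comb_continuous => i; exact: decode_continuous.
have cS : compact S.
  apply: bounded_closed_compact.
    by exists 1; split => // M M1 p /= [p1 _]; rewrite (le_trans p1)// ltW.
  apply: closedI.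
    apply: (@closed_comp _ _ (fun p : 'rV[R]_(n + n) => `|p|) [set x | x <= 1]).
      by move=> l _; exact: norm_continuous.
    exact: closed_le.
  apply: (@closed_comp _ _ (fun p => \sum_i scalar_abs (decode p i)) [set 1]).
    move=> p _; apply: sum_continuous => i _.
    by apply: scalar_abs_continuous; exact: decode_continuous.
  exact: closed_eq.
have G0 p : S p -> 0 < G p.
  move=> [_ p1]; rewrite lt_def vnorm_ge0 andbT; apply/eqP => /vnorm_eq0/free p0.
  move: p1; rewrite big1 => [/eqP|i _]; first by rewrite eq_sym oner_eq0.
  by rewrite p0 scalar_abs0.
have norm_ge d : 0 <= d -> (forall p, S p -> d <= G p) ->
    forall i v, d * scalar_abs (k i v : F) <= vnorm v.
  move=> d0 dG i v.
  pose t := \sum_j scalar_abs (k j v : F).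
  have kt j : scalar_abs (k j v : F) <= t.
    rewrite /t (bigD1 j)//= lerDl; apply: sumr_ge0 => ? _; exact: scalar_abs_ge0.
  have : 0 <= t := le_trans (scalar_abs_ge0 _) (kt i).
  rewrite le_eqVlt => /predU1P[t0|t0].
    have := kt i; rewrite -t0 => ki.
    by rewrite (le_trans (ler_wpM2l d0 ki))// mulr0 vnorm_ge0.
  pose c j : F := scalar_of_real t^-1 * k j v.
  have cE j : scalar_abs (c j) = t^-1 * scalar_abs (k j v : F).
    by rewrite scalar_absM scalar_abs_real ger0_norm// invr_ge0 ltW.
  have /dG : S (encode c).
    split.
      by apply: encode_norm => // j; rewrite cE mulrC ler_pdivrMr// mul1r.
    rewrite encodeK; under eq_bigr do rewrite cE.
    by rewrite -mulr_sumr mulVf// gt_eqF.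
  rewrite /G encodeK; under eq_bigr do rewrite -scalerA.
  have ti : 0 <= t^-1 by rewrite invr_ge0 ltW.
  rewrite -scaler_sumr -kE vnormZ scalar_abs_real (ger0_norm ti).
  rewrite mulrC ler_pdivlMr//; apply: le_trans.
  by rewrite ler_wpM2l.
have [S0|S0] := pselect (S !=set0).
  have [p /set_mem Sp pmin] := @EVT_min_rV R _ G S S0 cS (continuous_subspaceT cG).
  exists (G p)^-1 => [|i v]; first by rewrite invr_ge0 ltW// G0.
  rewrite mulrC ler_pdivlMr ?G0// mulrC; apply: norm_ge; first by rewrite ltW// G0.
  by move=> p' Sp'; apply: pmin; exact/mem_set.
exists 1 => // i v; rewrite mul1r -[leLHS]mul1r; apply: norm_ge => // p Sp.
by exfalso; apply: S0; exists p.
Qed.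

End Decode.

(** * Dual balls *)

Section DualBall.
Context {R : realType} {s : scalar_kind}.
Local Notation F := (scalar_field R s).
Context {V : lmodType F} (N : V -> R).
Hypothesis N0 : forall v, 0 <= N v.
Hypothesis NZ : forall (a : F) v, N (a *: v) = scalar_abs a * N v.
Implicit Type f : V -> F^o.

(** The supremum defining the dual norm is over vectors of norm at most 1;
    homogeneity of [N] spreads the bound to all vectors. *)
Lemma dual_normP f : dual N f ->
  forall v, scalar_abs (f v : F) <= dual_norm N f * N v.
Proof.
move=> [lf [M fM]] v.
have hs : has_sup [set scalar_abs (f v : F) | v in [set v | N v <= 1]].
  split.
    exists (scalar_abs (f 0 : F)), 0 => //=.
    by rewrite -(scale0r (0 : V)) NZ scalar_abs0 mul0r.
  exists `|M| => _ [u u1 <-]; apply: le_trans (fM u) _.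
  apply: le_trans (ler_norm _) _; rewrite normrM ler_piMr//.
  by rewrite ger0_norm.
have := N0 v; rewrite le_eqVlt => /predU1P[v0|v0].
  by have := fM v; rewrite -v0 !mulr0.
rewrite -ler_pdivrMr//; apply: ub_le_sup; first exact: hs.2.
have vi : 0 <= (N v)^-1 by rewrite invr_ge0 N0.
exists ((scalar_of_real (N v)^-1 : F) *: v) => /=.
  by rewrite NZ scalar_abs_real ger0_norm// mulVf// gt_eqF.
by rewrite linear_funZ// scalar_absM scalar_abs_real ger0_norm// mulrC.
Qed.

Lemma dual_norm_le f c : 0 <= c ->
  (forall v, scalar_abs (f v : F) <= c * N v) -> dual_norm N f <= c.
Proof.
move=> c0 fN; apply: ge_sup.
  exists (scalar_abs (f 0 : F)), 0 => //=.
  by rewrite -(scale0r (0 : V)) NZ scalar_abs0 mul0r.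
by move=> _ [v /= v1 <-]; apply: le_trans (fN v) _; rewrite ler_piMr.
Qed.

Lemma dual_ballP f : dual_ball N f <->
  linear f /\ forall v, scalar_abs (f v : F) <= N v.
Proof.
split=> [[df nf]|[lf fN]].
  split=> [|v]; first exact: df.1.
  by rewrite (le_trans (dual_normP df v))// ler_piMl.
split; last by apply: dual_norm_le => // v; rewrite mul1r.
by split=> //; exists 1 => v; rewrite mul1r.
Qed.

Lemma dual_sphere_ball f : dual_sphere N f -> dual_ball N f.
Proof. by move=> [df nf]; split; rewrite ?nf. Qed.

Lemma dual_sphere_attained f v : dual_ball N f -> 0 < N v ->
  N v <= scalar_abs (f v : F) -> dual_sphere N f.
Proof.
move=> [df nf] v0 fv; split => //; apply/eqP; rewrite eq_le nf/=.
by rewrite -(ler_pM2r v0) mul1r; apply: le_trans fv (dual_normP df v).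
Qed.

End DualBall.

(** * Bounded operators *)

Section BoundedOperatorTheory.
Context {R : realType} {s : scalar_kind}.
Local Notation F := (scalar_field R s).
Context {X : normedModType F}.
Implicit Type S : bounded_op X.

Lemma bounded_opP S : bounded_linear (@vnorm _ _ X) (@vnorm _ _ X) S.
Proof. by case: S => S /= /set_mem. Qed.

Lemma bounded_op_linear S : linear S.
Proof. exact: (bounded_opP S).1. Qed.

Lemma bounded_op_eq S S' : S =1 S' -> S = S'.
Proof. by move=> SS'; apply: val_inj; apply/funext. Qed.

Lemma bounded_opD S S' x : (S + S') x = S x + S' x.
Proof. by []. Qed.

Lemma bounded_opZ a S x : (a *: S) x = a *: S x.
Proof. by []. Qed.

Lemma bounded_op_sum (I : Type) (r : seq I) (P : pred I)
    (S : I -> bounded_op X) x :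
  (\sum_(i <- r | P i) S i) x = \sum_(i <- r | P i) S i x.
Proof. by apply: (big_morph (fun S : bounded_op X => S x)). Qed.

Lemma rank_one_op (f : X -> F^o) (C : R) (y : X) : linear f ->
  (forall x, scalar_abs (f x : F) <= C * vnorm x) ->
  exists S : bounded_op X, forall x, S x = (f x : F) *: y.
Proof.
move=> lf fC.
have P : (fun x => (f x : F) *: y) \in @bounded_op_pred R s X.
  rewrite inE; split.
    by move=> a u v; rewrite lf scalerDl scalerA.
  exists (C * vnorm y) => x; rewrite vnormZ mulrAC ler_wpM2r ?vnorm_ge0//.
by exists (BoundedOp P).
Qed.

End BoundedOperatorTheory.

(** * The joint numerical radius *)

Section JointNumericalRadiusTheory.
Context {R : realType} {s : scalar_kind}.
Local Notation F := (scalar_field R s).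
Context {X : normedModType F} {d : nat} (p : R) (hp : 1 < p).
Local Notation Z := {ffun 'I_d -> bounded_op X}.
Local Notation q := (hoelder_conj p).
Local Notation w := (@joint_numerical_radius R s X d p).
Implicit Types (u : X * (X -> F^o)) (S T : Z).

Let p0 : 0 < p. Proof. exact: lt_trans hp. Qed.

(** The value 1 at [u.1] already forces the functional to have norm 1. *)
Lemma state_pairsP u : state_pairs u <->
  [/\ vnorm u.1 = 1, linear u.2, forall x, scalar_abs (u.2 x : F) <= vnorm x
    & u.2 u.1 = 1].
Proof.
have N0 := @vnorm_ge0 R s X; have NZ := @vnormZ R s X.
split=> [[u1 /dual_sphere_ball/(dual_ballP N0 NZ)[lu2 u2] u12]|[u1 lu2 u2 u12]] //.
split=> //; apply: (@dual_sphere_attained R s X _ N0 NZ _ u.1).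
- exact/dual_ballP.
- by rewrite u1.
- by rewrite u1 u12 scalar_abs1.
Qed.

Definition pairing u S : 'I_d -> F := fun i => u.2 (S i u.1).

Lemma joint_valueE S u : joint_value p S u = lpnorm p (abs_family (pairing u S)).
Proof. by []. Qed.

Lemma joint_value_bounded S : has_ubound [set joint_value p S u | u in state_pairs].
Proof.
have /choice[M hM] i : exists M : R, forall x, vnorm (S i x) <= M * vnorm x.
  exact: (bounded_opP (S i)).2.
exists ((\sum_i M i `^ p) `^ p^-1) => _ [u /state_pairsP[u1 _ u2 _] <-].
apply: ge0_ler_powR; rewrite ?invr_ge0 ?(ltW p0)// ?nnegrE.
- by apply: sumr_ge0 => i _; exact: powR_ge0.
- by apply: sumr_ge0 => i _; exact: powR_ge0.
apply: ler_sum => i _.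
have h : scalar_abs (u.2 (S i u.1) : F) <= M i.
  by apply: (le_trans (u2 _)); have := hM i u.1; rewrite u1 mulr1.
have h0 := scalar_abs_ge0 (u.2 (S i u.1) : F).
by apply: ge0_ler_powR; rewrite ?(ltW p0)// ?nnegrE// (le_trans h0 h).
Qed.

Lemma joint_value_le S u : state_pairs u -> joint_value p S u <= w S.
Proof.
by move=> hu; apply: ub_le_sup; [exact: joint_value_bounded|exists u].
Qed.

Lemma joint_numerical_radius_ge0 S : 0 <= w S.
Proof.
have [[u hu]|h] := pselect (@state_pairs R s X !=set0).
  by apply: le_trans (joint_value_le S hu); exact: powR_ge0.
rewrite /joint_numerical_radius (_ : [set _ | _ in _] = set0) ?sup0//.
by apply/seteqP; split => // y [u hu _]; apply: h; exists u.
Qed.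

Lemma joint_valueZ (a : F) S u : state_pairs u ->
  joint_value p (a *: S) u = scalar_abs a * joint_value p S u.
Proof.
move=> /state_pairsP[_ lu2 _ _].
rewrite /joint_value (eq_bigr (fun i => scalar_abs a `^ p *
    scalar_abs (u.2 (S i u.1) : F) `^ p)); last first.
  move=> i _; rewrite -powRM ?scalar_abs_ge0// -scalar_absM.
  congr (scalar_abs _ `^ _).
  by rewrite ffunE bounded_opZ linear_funZ.
rewrite -mulr_sumr powRM ?powR_ge0//; last first.
  by apply: sumr_ge0 => i _; exact: powR_ge0.
by rewrite -powRrM mulfV ?gt_eqF// powRr1// scalar_abs_ge0.
Qed.

Lemma joint_numerical_radiusZ (a : F) S : w (a *: S) = scalar_abs a * w S.
Proof.
have le b S' : w (b *: S') <= scalar_abs b * w S'.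
  have [[u0 hu0]|h] := pselect (@state_pairs R s X !=set0).
    apply: ge_sup; first by exists (joint_value p (b *: S') u0), u0.
    move=> _ [u hu <-]; rewrite joint_valueZ// ler_wpM2l ?scalar_abs_ge0//.
    exact: joint_value_le.
  rewrite [leLHS]/joint_numerical_radius (_ : [set _ | _ in _] = set0).
    by rewrite sup0 mulr_ge0 ?scalar_abs_ge0 ?joint_numerical_radius_ge0.
  by apply/seteqP; split => // y [u hu _]; apply: h; exists u.
apply/eqP; rewrite eq_le le/=.
have [->|a0] := eqVneq a 0.
  by rewrite scalar_abs0 mul0r joint_numerical_radius_ge0.
have a1 : 0 < scalar_abs a.
  by rewrite lt_def scalar_abs_ge0 andbT; apply: contra_neq a0 => /scalar_abs_eq0.
rewrite -{1}(scalerK a0 S) -ler_pdivlMl//.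
rewrite (_ : (scalar_abs a)^-1 = scalar_abs a^-1); first exact: le.
apply: (mulfI (lt0r_neq0 a1)).
by rewrite mulfV ?gt_eqF// -scalar_absM mulfV// scalar_abs1.
Qed.

Lemma joint_value_ge S u i : scalar_abs (u.2 (S i u.1) : F) <= joint_value p S u.
Proof.
have h0 := scalar_abs_ge0 (u.2 (S i u.1) : F).
rewrite -[leLHS](powRr1 h0) -(mulfV (lt0r_neq0 p0)) powRrM.
apply: ge0_ler_powR; rewrite ?invr_ge0 ?(ltW p0)// ?nnegrE ?powR_ge0//.
  by apply: sumr_ge0 => j _; exact: powR_ge0.
rewrite (bigD1 i)//= lerDl; apply: sumr_ge0 => j _; exact: powR_ge0.
Qed.

(** Positivity is inherited from the numerical radius of a nonzero entry. *)
Lemma joint_numerical_radius_gt0 S :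
  is_norm (@numerical_radius R s X) -> S != 0 -> 0 < w S.
Proof.
move=> [n0 n1 _ _] S0.
have [i Si] : exists i, S i != 0.
  apply: contrapT => h; move/eqP: S0; apply; apply/ffunP => i; rewrite ffunE.
  by apply/eqP/negPn/negP => Si; apply: h; exists i.
have r0 : 0 < numerical_radius (S i).
  by rewrite lt_def n0 andbT; apply: contra_neq Si => /n1.
have [A0|A0] := pselect ([set scalar_abs (u.2 (S i u.1) : F) | u in
    @state_pairs R s X] !=set0); last first.
  by move: r0; rewrite /numerical_radius ((nonemptyPn _).1 A0) sup0 ltxx.
have [_ [u hu <-] ui] := sup_gt A0 r0.
exact: lt_le_trans ui (le_trans (joint_value_ge S u i) (joint_value_le S hu)).
Qed.

Lemma tensor_functional_linear (a : 'I_d -> F) u : linear u.2 ->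
  linear (tensor_functional a u).
Proof.
move=> lu b S S'; rewrite /tensor_functional scaler_sumr -big_split.
apply: eq_bigr => i _ /=.
by rewrite !ffunE bounded_opD bounded_opZ lu mulrDr; congr (_ + _); exact: mulrCA.
Qed.

Lemma tensor_functional_le (a : 'I_d -> F) u S : state_pairs u ->
  \sum_i scalar_abs (a i) `^ q <= 1 ->
  scalar_abs (tensor_functional a u S : F) <= w S.
Proof.
move=> hu a1; apply: le_trans (joint_value_le S hu).
exact: (scalar_hoelder hp (pairing u S) a1).
Qed.

End JointNumericalRadiusTheory.

(** * Compactness of the unit tensors *)

Lemma powR_norm_continuous (R : realType) (q : R) : 0 < q ->
  continuous (fun x : R => `|x| `^ q).
Proof.
move=> q0 x; have [->|x0] := eqVneq x 0.
  rewrite /continuous_at normr0 powR0 ?gt_eqF//.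
  apply/cvgrPdist_lt => e e0; near=> y.
  rewrite sub0r normrN ger0_norm ?powR_ge0//.
  rewrite -[ltRHS](powRr1 (ltW e0)) -(mulVf (lt0r_neq0 q0)) powRrM.
  apply: gt0_ltr_powR => //; rewrite ?nnegrE ?powR_ge0//.
  near: y; exists (e `^ q^-1) => /=; first by rewrite powR_gt0.
  by move=> z /=; rewrite sub0r normrN.
have xp : 0 < `|x| by rewrite normr_gt0.
rewrite /continuous_at.
have E (y : R) : y != 0 -> expR (q * ln `|y|) = `|y| `^ q.
  by move=> y0; rewrite /powR normr_eq0 (negbTE y0).
rewrite -(E _ x0); apply: (@cvg_trans _ (expR (q * ln `|y|) @[y --> x])).
  apply: near_eq_cvg.
  have : \forall y \near x, y != 0.
    by apply: open_nbhs_nbhs; split; [exact: open_neq|].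
  by apply: filterS => y /E.
apply: (@continuous_comp _ _ _ (fun y : R => q * ln `|y|) expR); last first.
  exact: continuous_expR.
apply: cvgM; first exact: cvg_cst.
apply: (@continuous_comp _ _ _ (fun y : R => `|y|) (@ln R)).
  exact: norm_continuous.
exact: continuous_ln.
Unshelve. all: by end_near. Qed.

Section UnitTensors.
Context {R : realType} {s : scalar_kind}.
Local Notation F := (scalar_field R s).
Context {X : normedModType F} {d : nat} (p : R) (hp : 1 < p).
Local Notation Z := {ffun 'I_d -> bounded_op X}.
Local Notation q := (hoelder_conj p).
Local Notation w := (@joint_numerical_radius R s X d p).

Definition unit_tensors : set (Z -> F^o) :=
  [set g | exists a u, [/\ state_pairs u, \sum_i scalar_abs (a i : F) `^ q <= 1
    & g = tensor_functional a u]].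

Variables (n : nat) (e : 'I_n -> X) (k : 'I_n -> X -> F^o).
Hypothesis k_linear : forall i, linear (k i).
Hypothesis kE : forall v, v = \sum_i k i v *: e i.
Hypothesis e_free :
  forall c : 'I_n -> F, \sum_i c i *: e i = 0 -> forall i, c i = 0.

Lemma linear_coords (f : X -> F^o) x : linear f ->
  f x = \sum_i k i x * f (e i).
Proof. by move=> lf; rewrite {1}(kE x) linear_fun_sum. Qed.

Lemma elementary_op i j :
  exists S : bounded_op X, forall x, S x = (k i x : F) *: e j.
Proof.
have [M _ hM] := coords_bounded kE e_free.
exact: (rank_one_op _ (k_linear i) (hM i)).
Qed.

(** Here [E] plays the part of the matrix units. *)
Lemma bounded_op_expand (E : 'I_n -> 'I_n -> bounded_op X) (S : bounded_op X) :
  (forall i j x, E i j x = (k i x : F) *: e j) ->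
  S = \sum_i \sum_j (k j (S (e i)) : F) *: E i j.
Proof.
move=> EE; apply: bounded_op_eq => x; rewrite bounded_op_sum.
rewrite {1}(kE x) (linear_fun_sum (bounded_op_linear S)).
apply: eq_bigr => i _; rewrite bounded_op_sum {1}(kE (S (e i))) scaler_sumr.
by apply: eq_bigr => j _; rewrite bounded_opZ EE !scalerA mulrC.
Qed.

Lemma operator_tuples_span :
  exists b : 'I_d * 'I_n * 'I_n -> Z,
    forall S, exists c : 'I_d * 'I_n * 'I_n -> F, S = \sum_t c t *: b t.
Proof.
have /choice[E' hE'] i : exists E : 'I_n -> bounded_op X, forall j x,
    E j x = (k i x : F) *: e j.
  by have [E hE] := choice (elementary_op i); exists E.
exists (fun t => [ffun l => if l == t.1.1 then E' t.1.2 t.2 else 0]) => S.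
exists (fun t => k t.2 (S t.1.1 (e t.1.2))); apply/ffunP => l.
rewrite (bounded_op_expand (S l) hE').
pose G (t : 'I_d * 'I_n * 'I_n) : bounded_op X :=
  (k t.2 (S t.1.1 (e t.1.2)) : F) *: (if l == t.1.1 then E' t.1.2 t.2 else 0).
rewrite sum_ffunE (eq_bigr G); last by move=> t _; rewrite !ffunE.
rewrite -(pair_bigA _ (fun a j => G (a, j)))/=.
rewrite -(pair_bigA _ (fun l i => \sum_j G (l, i, j)))/=.
rewrite [RHS](bigD1 l)//= [X in _ = _ + X]big1 ?addr0 => [|l' ll'].
  apply: eq_bigr => i _; apply: eq_bigr => j _.
  by rewrite /G /= eqxx.
rewrite big1// => i _; rewrite big1// => j _.
by rewrite /G /= eq_sym (negbTE ll') scaler0.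
Qed.

(** Parameters of a unit tensor: the coordinates of the vector, the values of
    the functional on the basis, and the weights. *)
Local Notation params := 'rV[R]_((n + n + d) + (n + n + d)).

Definition param_vec (P : params) : X :=
  \sum_i (decode P (lshift d (lshift n i)) : F) *: e i.
Definition param_dual (P : params) : X -> F^o :=
  fun x => \sum_i (k i x : F) * decode P (lshift d (rshift n i)).
Definition param_weights (P : params) : 'I_d -> F :=
  fun i => decode P (rshift (n + n) i).
Definition param_tensor (P : params) : Z -> F^o :=
  tensor_functional (param_weights P) (param_vec P, param_dual P).

Lemma param_dual_continuous x : scalar_continuous (fun P => param_dual P x : F).
Proof.
apply: scalar_continuous_sum => i _; apply: scalar_continuousM.
  exact: scalar_continuous_cst.
exact: decode_continuous.
Qed.

Lemma param_dual_op_continuous (S : X -> X) : linear S ->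
  scalar_continuous (fun P => param_dual P (S (param_vec P)) : F).
Proof.
move=> lS; apply: scalar_continuous_sum => i _.
apply: scalar_continuousM; last exact: decode_continuous.
rewrite (_ : (fun _ => _) = fun P : params =>
    \sum_j decode P (lshift d (lshift n j)) * (k i (S (e j)) : F)); last first.
  by apply/funext => P; rewrite /param_vec !linear_fun_sum.
apply: scalar_continuous_sum => j _.
apply: scalar_continuousM; first exact: decode_continuous.
exact: scalar_continuous_cst.
Qed.

Lemma param_tensor_continuous S : scalar_continuous (fun P => param_tensor P S : F).
Proof.
apply: scalar_continuous_sum => i _; apply: scalar_continuousM.
  exact: decode_continuous.
exact: param_dual_op_continuous (bounded_op_linear _).
Qed.

Lemma param_dual_linear P : linear (param_dual P).
Proof.
move=> a x y; rewrite /param_dual scaler_sumr -big_split; apply: eq_bigr => i _ /=.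
by rewrite k_linear mulrDl; congr (_ + _); rewrite -mulrA.
Qed.

Lemma param_surjective (a : 'I_d -> F) (x : X) (f : X -> F^o) : linear f ->
  exists P, [/\ param_vec P = x, param_dual P = f & param_weights P = a] /\
    forall r, 0 <= r -> (forall i, scalar_abs (k i x : F) <= r) ->
      (forall i, scalar_abs (f (e i) : F) <= r) ->
      (forall i, scalar_abs (a i) <= r) -> `|P| <= r.
Proof.
move=> lf.
pose c (t : 'I_(n + n + d)) : F := match fintype.split t with
  | inl t' => match fintype.split t' with inl i => k i x | inr i => f (e i) end
  | inr i => a i
  end.
have cl i : c (lshift d (lshift n i)) = k i x.
  by rewrite /c (unsplitK (inl _)) (unsplitK (inl _)).
have cr i : c (lshift d (rshift n i)) = f (e i).
  by rewrite /c (unsplitK (inl _)) (unsplitK (inr _)).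
have ca i : c (rshift (n + n) i) = a i by rewrite /c (unsplitK (inr _)).
exists (encode c); split; first split.
- by rewrite /param_vec encodeK [RHS]kE; apply: eq_bigr => i _; rewrite cl.
- apply/funext => y; rewrite /param_dual encodeK (linear_coords y lf).
  by apply: eq_bigr => i _; rewrite cr.
- by rewrite /param_weights encodeK; apply/funext => i; rewrite ca.
move=> r r0 kr fr ar; apply: encode_norm => // t; rewrite /c.
by case: fintype.split => [t'|i] //; case: fintype.split.
Qed.

(** The unit tensors are the continuous image of a bounded closed set of
    parameters. *)
Lemma unit_tensors_compact (J : finType) (b : J -> Z) :
  compact (real_coords b @` unit_tensors).
Proof.
have q0 : 0 < q := hoelder_conj_gt0 hp.
have [M M0 hM] := coords_bounded kE e_free.
(* [M] bounds the coordinates of the vector, the sum bounds the values of the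
   functional on the basis, and 1 bounds the weights *)
pose B := M + \sum_i vnorm (e i) + 1.
have e0 : 0 <= \sum_i vnorm (e i) by apply: sumr_ge0 => i _; exact: vnorm_ge0.
pose D1 : set params := [set P | `|P| <= B].
pose D2 : set params := [set P | vnorm (param_vec P) = 1].
pose D3 : set params :=
  \bigcap_x [set P | scalar_abs (param_dual P x : F) <= vnorm x].
(* the real part is enough: the modulus is at most 1 on [D2] and [D3] *)
pose D4 : set params := [set P | scalar_re (param_dual P (param_vec P) : F) = 1].
pose D5 : set params :=
  [set P | \sum_i `|scalar_abs (param_weights P i)| `^ q <= 1].
pose D := D1 `&` (D2 `&` (D3 `&` (D4 `&` D5))).
have DE : real_coords b @` unit_tensors = (real_coords b \o param_tensor) @` D.
  apply/seteqP; split=> g [].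
    move=> _ [a [u [/state_pairsP[u1 lu2 u2 u12] a1 ->]]] <-.
    have [P [[Pv Pd Pw] PB]] := param_surjective a u.1 lu2.
    exists P; last by rewrite /= /param_tensor Pv Pd Pw -surjective_pairing.
    split; first (apply: PB => [|i|i|i]).
    - by rewrite !addr_ge0.
    - by apply: (le_trans (hM i _)); rewrite u1 mulr1 /B -addrA lerDl addr_ge0.
    - apply: (le_trans (u2 _)).
      have : vnorm (e i) <= \sum_j vnorm (e j).
        rewrite (bigD1 i)//= lerDl; apply: sumr_ge0 => j _; exact: vnorm_ge0.
      by rewrite /B; lra.
    - apply: (@le_trans _ _ 1); last by rewrite lerDr addr_ge0.
      rewrite leNgt; apply/negP => ai.
      have : 1 < scalar_abs (a i) `^ q.
        have E1 : 1 `^ q = 1 by rewrite powR1.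
        rewrite -[ltLHS]E1; apply: gt0_ltr_powR => //; rewrite nnegrE//.
        exact: scalar_abs_ge0.
      apply/negP; rewrite -leNgt; apply: le_trans a1; rewrite (bigD1 i)//= lerDl.
      by apply: sumr_ge0 => j _; exact: powR_ge0.
    split; first by rewrite /D2/= Pv.
    split; first by move=> x _ /=; rewrite Pd.
    split; first by rewrite /D4/= Pd Pv u12 scalar_re1.
    rewrite /D5/= Pw; under eq_bigr do rewrite ger0_norm ?scalar_abs_ge0//.
    exact: a1.
  move=> P [_ [P2 [P3 [P4 P5]]]] <-; exists (param_tensor P) => //.
  exists (param_weights P), (param_vec P, param_dual P); split => //.
    apply/state_pairsP; split => //=.
    - exact: param_dual_linear.
    - by move=> x; exact: P3.
    - rewrite [LHS]scalar_re_eq_abs P4 ?scalar_of_real1//.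
      by apply: (le_trans (P3 (param_vec P) I)); rewrite P2.
  apply: le_trans P5; apply: ler_sum => i _.
  by rewrite ger0_norm// scalar_abs_ge0.
have cD : compact D.
  apply: bounded_closed_compact.
    exists B; split; first exact: num_real.
    by move=> r Br P [/= PB _]; rewrite (le_trans PB)// ltW.
  apply: closedI.
    apply: (@closed_comp _ _ (fun P : params => `|P|) [set x | x <= B]).
      by move=> l _; exact: norm_continuous.
    exact: closed_le.
  apply: closedI.
    apply: (@closed_comp _ _ (fun P : params => vnorm (param_vec P)) [set 1]).
      by move=> P _; apply: vnorm_comb_continuous => i; exact: decode_continuous.
    exact: closed_eq.
  apply: closedI.
    apply: closed_bigI => x _.
    apply: (@closed_comp _ _ (fun P : params => scalar_abs (param_dual P x : F))
      [set y | y <= vnorm x]).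
      by move=> P _; apply: scalar_abs_continuous; exact: param_dual_continuous.
    exact: closed_le.
  apply: closedI.
    apply: (@closed_comp _ _ (fun P : params =>
      scalar_re (param_dual P (param_vec P) : F)) [set 1]).
      by move=> P _; exact: (@param_dual_op_continuous id (fun _ _ _ => erefl)).1.
    exact: closed_eq.
  apply: (@closed_comp _ _ (fun P : params =>
    \sum_i `|scalar_abs (param_weights P i)| `^ q) [set y | y <= 1]).
    move=> P _; apply: sum_continuous => i _ P'.
    apply: (@continuous_comp _ _ _ (fun P => scalar_abs (param_weights P i))
      (fun x => `|x| `^ q)); last exact: powR_norm_continuous.
    by apply: scalar_abs_continuous; exact: decode_continuous.
  exact: closed_le.
rewrite DE; apply: continuous_compact => //.
apply: continuous_subspaceT; apply: row_continuous => j.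
rewrite -(splitK j); case: (fintype.split j) => i /=.
  under eq_fun do rewrite row_mxEl mxE.
  exact: (param_tensor_continuous _).1.
under eq_fun do rewrite row_mxEr mxE.
exact: (param_tensor_continuous _).2.
Qed.

End UnitTensors.

(** * Extreme unit tensors *)

Section FiniteDimensionalDual.
Context {R : realType} {s : scalar_kind}.
Local Notation F := (scalar_field R s).
Context {X : normedModType F} (hX : finite_dimensional X).

Lemma linear_functional_bounded (f : X -> F^o) : linear f ->
  exists C, forall x, scalar_abs (f x : F) <= C * vnorm x.
Proof.
move=> lf; have [n [e [k [kl kE free]]]] := finite_dimensional_coords hX.
have [M M0 hM] := coords_bounded kE free.
exists (\sum_i M * scalar_abs (f (e i) : F)) => x.
rewrite (linear_coords kE x lf) mulr_suml; apply: le_trans (scalar_abs_sum _ _ _) _.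
apply: ler_sum => i _; rewrite scalar_absM mulrAC.
by rewrite ler_wpM2r// scalar_abs_ge0.
Qed.

Lemma linear_functionals_separate (x y : X) :
  (forall f : X -> F^o, linear f -> f x = f y) -> x = y.
Proof.
move=> h; have [n [e [k [kl kE free]]]] := finite_dimensional_coords hX.
by rewrite (kE x) (kE y); apply: eq_bigr => i _; rewrite h.
Qed.

End FiniteDimensionalDual.

Section ExtremeTensors.
Context {R : realType} {s : scalar_kind}.
Local Notation F := (scalar_field R s).

(** Real parts that are at most 1 average to 1 only if all of them are 1, and
    then the imaginary parts vanish because the moduli are at most 1. *)
Lemma scalar_one_extreme (t : R) (a b : F) : 0 < t -> t < 1 ->
  scalar_abs a <= 1 -> scalar_abs b <= 1 ->
  1 = scalar_of_real t * a + (1 - scalar_of_real t) * b -> a = 1 /\ b = 1.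
Proof.
move=> t0 t1 a1 b1 /(congr1 scalar_re).
rewrite -scalar_of_real1 -scalar_of_realB scalar_reD !scalar_reM.
rewrite !scalar_re_real !scalar_im_real !mul0r !subr0 => E.
have ra := le_trans (ler_norm _) (scalar_re_le_abs a).
have rb := le_trans (ler_norm _) (scalar_re_le_abs b).
have Ea : scalar_re a = 1 by nra.
have Eb : scalar_re b = 1 by nra.
by split; rewrite [LHS]scalar_re_eq_abs ?Ea ?Eb ?scalar_of_real1.
Qed.

Context {X : normedModType F} {d : nat} (p : R) (hp : 1 < p).
Local Notation Z := {ffun 'I_d -> bounded_op X}.
Local Notation q := (hoelder_conj p).
Local Notation w := (@joint_numerical_radius R s X d p).
Implicit Types (a : 'I_d -> F) (u : X * (X -> F^o)) (S T : Z).

Lemma tensor_functional_single a u i (S : bounded_op X) : linear u.2 ->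
  tensor_functional a u ([ffun l => if l == i then S else 0] : Z) =
  a i * u.2 (S u.1).
Proof.
move=> lu; rewrite /tensor_functional (bigD1 i)//= ffunE eqxx.
rewrite big1 ?addr0// => l /negbTE li; rewrite ffunE li.
by rewrite (_ : (0 : bounded_op X) u.1 = 0)// linear_fun0// mulr0.
Qed.

Lemma tensor_functional_neq0 a u T : tensor_functional a u T != 0 ->
  exists i, a i != 0.
Proof.
move=> h; apply: contrapT => a0; move/eqP: h; apply.
rewrite /tensor_functional big1// => i _.
have [->|ai] := eqVneq (a i) 0; first by rewrite mul0r.
by exfalso; apply: a0; exists i.
Qed.

Section ExtremeComponents.
Hypothesis hX : finite_dimensional X.
Variables (a : 'I_d -> F) (u : X * (X -> F^o)) (i : 'I_d).
Hypothesis a_norm : \sum_j scalar_abs (a j) `^ q <= 1.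
Hypothesis ai0 : a i != 0.
Hypothesis hu : state_pairs u.
Hypothesis ext : extreme_points (unit_tensors p) (tensor_functional a u : Z -> F^o).

Let lu : linear u.2. Proof. by have /state_pairsP[] := hu. Qed.

(* only the [i]-th entry of the tuple of operators is used, where the weight is
   nonzero *)
Let tensor_at (v : X) (f : X -> F^o) (S : bounded_op X) : linear f ->
  tensor_functional a (v, f) = tensor_functional a u :> (Z -> F^o) ->
  f (S v) = u.2 (S u.1).
Proof.
move=> lf E; apply: (mulfI ai0).
rewrite -(tensor_functional_single a i (u := (v, f)) S lf) E.
by rewrite tensor_functional_single.
Qed.

(** A proper convex decomposition of one factor of the tensor decomposes the
    tensor among unit tensors, hence is trivial there; operators of rank one
    then recover the factor from the tensor. *)
Lemma tensor_extreme_vec : extreme_points [set x : X | vnorm x <= 1] u.1.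
Proof.
have /state_pairsP[u1 _ u2 u12] := hu.
split; first by rewrite /= u1.
move=> y z t /= y1 z1 t0 t1 uyz.
have [r [r0 r1 tr]] := convex_weight_real t0 t1.
have uE : u.2 u.1 = t * u.2 y + (1 - t) * u.2 z :> F.
  by rewrite {1}uyz (linear_funD lu) !(linear_funZ lu).
have [fy fz] : u.2 y = 1 /\ u.2 z = 1.
  apply: (@scalar_one_extreme r) => //.
  - exact: le_trans (u2 _) y1.
  - exact: le_trans (u2 _) z1.
  - by rewrite -tr -uE.
have state v : vnorm v <= 1 -> u.2 v = 1 -> state_pairs (v, u.2).
  move=> v1 fv; apply/state_pairsP; split => //=; apply/eqP.
  by rewrite eq_le v1; have := u2 v; rewrite fv scalar_abs1.
have [||//|//||ey ez] := ext.2 (tensor_functional a (y, u.2))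
  (tensor_functional a (z, u.2)) t.
- by exists a, (y, u.2); split => //; exact: state.
- by exists a, (z, u.2); split => //; exact: state.
- apply/funext => S; change (tensor_functional a u S =
    t * tensor_functional a (y, u.2) S + (1 - t) * tensor_functional a (z, u.2) S).
  rewrite /tensor_functional !mulr_sumr -big_split; apply: eq_bigr => j _ /=.
  rewrite {1}uyz (linear_funD (bounded_op_linear _)).
  rewrite !(linear_funZ (bounded_op_linear _)).
  rewrite (linear_funD lu) !(linear_funZ lu) mulrDr.
  by congr (_ + _); exact: mulrCA.
suff read v : tensor_functional a (v, u.2) = tensor_functional a u :> (Z -> F^o) ->
    v = u.1 by split; exact: read.
move=> ev; apply: (linear_functionals_separate hX) => f lf.
have [C fC] := linear_functional_bounded hX lf.
have [S SE] := rank_one_op u.1 lf fC.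
have := tensor_at S lu ev; rewrite !SE !(linear_funZ lu) u12.
by rewrite /GRing.scale/= !mulr1.
Qed.

(** As for the vector, with the operators that send [u.1] to a given vector. *)
Lemma tensor_extreme_dual : extreme_points (dual_ball (@vnorm _ _ X)) u.2.
Proof.
have N0 := @vnorm_ge0 R s X; have NZ := @vnormZ R s X.
have /state_pairsP[u1 _ u2 u12] := hu.
split; first exact/dual_ballP.
move=> f g t /(dual_ballP N0 NZ)[lf f1] /(dual_ballP N0 NZ)[lg g1] t0 t1 ufg.
have uE x : u.2 x = t * f x + (1 - t) * g x by rewrite ufg.
have [r [r0 r1 tr]] := convex_weight_real t0 t1.
have [fu gu] : f u.1 = 1 /\ g u.1 = 1.
  apply: (@scalar_one_extreme r) => //.
  - by rewrite -u1; exact: f1.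
  - by rewrite -u1; exact: g1.
  - by rewrite -tr -uE.
have [||//|//||ef eg] := ext.2 (tensor_functional a (u.1, f))
  (tensor_functional a (u.1, g)) t.
- by exists a, (u.1, f); split => //; apply/state_pairsP.
- by exists a, (u.1, g); split => //; apply/state_pairsP.
- apply/funext => S; change (tensor_functional a u S =
    t * tensor_functional a (u.1, f) S + (1 - t) * tensor_functional a (u.1, g) S).
  rewrite /tensor_functional !mulr_sumr -big_split; apply: eq_bigr => j _ /=.
  by rewrite uE mulrDr; congr (_ + _); exact: mulrCA.
have [C uC] := linear_functional_bounded hX lu.
suff read h : linear h ->
    tensor_functional a (u.1, h) = tensor_functional a u :> (Z -> F^o) -> h = u.2.
  by split; exact: read.
move=> lh eh; apply/funext => y.
have [S SE] := rank_one_op y lu uC.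
by have := tensor_at S lh eh; rewrite !SE u12 !scale1r.
Qed.

End ExtremeComponents.
End ExtremeTensors.

(** * Norming functionals *)

Section NormingFunctionals.
Context {R : realType} {s : scalar_kind}.
Local Notation F := (scalar_field R s).
Context {X : normedModType F} {d : nat} (p : R) (hp : 1 < p).
Local Notation Z := {ffun 'I_d -> bounded_op X}.
Local Notation q := (hoelder_conj p).
Local Notation w := (@joint_numerical_radius R s X d p).
Variable T : Z.
Hypothesis wT0 : 0 < w T.

Lemma norming_functionalsP (f : Z -> F^o) : norming_functionals p T f <->
  [/\ linear f, forall S, scalar_abs (f S : F) <= w S & f T = scalar_of_real (w T)].
Proof.
have N0 := @joint_numerical_radius_ge0 R s X d p hp.
have NZ := @joint_numerical_radiusZ R s X d p hp.
split=> [[/dual_sphere_ball/(dual_ballP N0 NZ)[lf fw] fT]|[lf fw fT]] //.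
split=> //; apply: (@dual_sphere_attained _ _ _ _ N0 NZ _ T) => //.
  exact/(dual_ballP N0 NZ).
by rewrite fT scalar_abs_real ler_norm.
Qed.

Lemma extreme_functional_weights u : joint_value p T u = w T ->
  scalar_of_real ((w T `^ (p - 1))^-1) *:
    tensor_functional (fun i => conj_powR p (u.2 (T i u.1))) u =
  tensor_functional (norming_weights p (w T) (pairing u T)) u :> (Z -> F^o).
Proof.
move=> uT; apply/funext => S; rewrite /tensor_functional.
change (scalar_of_real ((w T `^ (p - 1))^-1) *
    (\sum_i conj_powR p (u.2 (T i u.1)) * u.2 (S i u.1)) =
  \sum_i norming_weights p (w T) (pairing u T) i * u.2 (S i u.1) :> F).
by rewrite mulr_sumr; apply: eq_bigr => i _; rewrite mulrA.
Qed.

Lemma extreme_functionals_norming :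
  extreme_functionals p T `<=` norming_functionals p T.
Proof.
move=> _ [u [[hu uT] _ _] <-]; rewrite extreme_functional_weights//.
have cN : lpnorm p (abs_family (pairing u T)) = w T by rewrite -uT.
have N0 : 0 < lpnorm p (abs_family (pairing u T)) by rewrite cN.
have /state_pairsP[_ lu _ _] := hu.
apply/norming_functionalsP; split.
- exact: tensor_functional_linear.
- move=> S; apply: tensor_functional_le => //.
  by rewrite -cN norming_weights_norm.
- by rewrite -cN; exact: (norming_weights_pair hp N0).
Qed.

Lemma norming_functionals_convex (f g : Z -> F^o) (t : F) :
  norming_functionals p T f -> norming_functionals p T g -> 0 < t -> t < 1 ->
  norming_functionals p T (t *: f + (1 - t) *: g).
Proof.
move=> /norming_functionalsP[lf fw fT] /norming_functionalsP[lg gw gT] t0 t1.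
have [r [r0 r1 ->]] := convex_weight_real t0 t1.
apply/norming_functionalsP; split; first exact: linear_comb.
  move=> S; change (scalar_abs (scalar_of_real r * f S +
    (1 - scalar_of_real r) * g S : F) <= w S).
  apply: le_trans (scalar_absD _ _) _.
  rewrite -scalar_of_real1 -scalar_of_realB !scalar_absM !scalar_abs_real.
  have s0 : 0 <= 1 - r by rewrite subr_ge0 ltW.
  rewrite (ger0_norm (ltW r0)) (ger0_norm s0).
  by have := fw S; have := gw S; nra.
change (scalar_of_real r * f T + (1 - scalar_of_real r) * g T =
  scalar_of_real (w T) :> F).
by rewrite fT gT -mulrDl addrC subrK mul1r.
Qed.

(** By Hoelder duality the unit tensors norm every [S], so no [S] separates the
    dual ball from them. *)
Lemma dual_ball_le_unit_tensors (f : Z -> F^o) S r :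
  (forall S, scalar_abs (f S : F) <= w S) -> @state_pairs R s X !=set0 ->
  (forall g, unit_tensors p g -> scalar_re (g S : F) <= r) ->
  scalar_re (f S : F) <= r.
Proof.
move=> fw [u0 hu0] hr.
apply: (le_trans (ler_norm _)); apply: (le_trans (scalar_re_le_abs _)).
apply: (le_trans (fw S)); apply: ge_sup; first by exists (joint_value p S u0), u0.
move=> _ [u hu <-]; rewrite joint_valueE.
have [->|Nn0] := eqVneq (lpnorm p (abs_family (pairing u S))) 0.
  have := hr (tensor_functional (fun=> 0) u).
  rewrite /tensor_functional big1 ?scalar_re0 => [|i _]; last by rewrite mul0r.
  apply; exists (fun=> 0), u; split => //; rewrite big1// => i _.
  by rewrite scalar_abs0 powR0// gt_eqF// hoelder_conj_gt0.
have N0 : 0 < lpnorm p (abs_family (pairing u S)).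
  by rewrite lt_def Nn0 lpnorm_ge0.
rewrite -(scalar_re_real (s := s) (lpnorm _ _)) -(norming_weights_pair hp N0).
apply: (hr (tensor_functional _ u)).
by eexists; exists u; split => //; rewrite norming_weights_norm.
Qed.

(** A unit tensor attaining [w T] is a Hoelder equality case, which determines
    its weights. *)
Lemma extreme_unit_tensor_norming (hX : finite_dimensional X) (g : Z -> F^o) :
  extreme_points (unit_tensors p) g -> w T <= scalar_re (g T : F) ->
  extreme_functionals p T g.
Proof.
move=> extg wg; have [[a [u [hu a1 gE]]] _] := extg; subst g.
have cw : joint_value p T u <= w T := joint_value_le hp T hu.
have ca : scalar_abs (tensor_functional a u T : F) <= joint_value p T u.
  exact: (scalar_hoelder hp (pairing u T) a1).
have cr := le_trans (ler_norm _) (scalar_re_le_abs (tensor_functional a u T : F)).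
have uT : joint_value p T u = w T.
  by apply: le_anti; rewrite cw (le_trans wg)// (le_trans cr).
have N0 : 0 < lpnorm p (abs_family (pairing u T)) by rewrite -joint_valueE uT.
have aE : a = norming_weights p (w T) (pairing u T).
  rewrite -uT; apply: (norming_weights_uniq hp N0 a1).
  by rewrite -joint_valueE uT.
have [i ai] : exists i, a i != 0.
  apply: (@tensor_functional_neq0 _ _ _ _ _ u T).
  by apply: contraTneq wg => ->; rewrite scalar_re0 -ltNge.
exists u; first split => //.
- exact: (tensor_extreme_vec hX a1 ai hu extg).
- exact: (tensor_extreme_dual hX a1 ai hu extg).
- by rewrite extreme_functional_weights// -aE.
Qed.

End NormingFunctionals.

Theorem theorem3p1 (R : realType) (s : scalar_kind)
    (X : completeNormedModType (scalar_field R s)) (d : nat) (p : R)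
    (hX : finite_dimensional X)
    (hw : is_norm (@numerical_radius R s X))
    (hd : (1 <= d)%N) (hp : 1 < p)
    (T : {ffun 'I_d -> bounded_op X}) (hT : T != 0) :
  norming_functionals p T = convex_hull (extreme_functionals p T).
Proof.
have wT0 := joint_numerical_radius_gt0 hp hw hT.
apply/seteqP; split=> [f|]; last first.
  apply: convex_hull_min; first exact: extreme_functionals_norming.
  by move=> f g t; exact: norming_functionals_convex.
move=> /(norming_functionalsP hp wT0)[lf fw fT].
have state0 : @state_pairs R s X !=set0.
  apply: contrapT => /nonemptyPn E; move: wT0.
  by rewrite /joint_numerical_radius E image_set0 sup0 ltxx.
have [n [e [k [kl kE free]]]] := finite_dimensional_coords hX.
have [b b_span] := operator_tuples_span (d := d) kl kE free.
have hull : convex_hull (extreme_points (unit_tensors p)) f.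
  apply: (dual_krein_milman b_span) => //.
  - move=> _ [a [u [/state_pairsP[_ lu _ _] _ ->]]].
    exact: tensor_functional_linear.
  - exact: (unit_tensors_compact hp kl kE free).
  - by move=> S r; exact: dual_ball_le_unit_tensors.
have face := convex_hull_face (l := fun g => scalar_re (g T))
  (w := joint_numerical_radius p T) _ _ hull.
apply: convex_hullS (face _ _ _).
- by move=> g [/(extreme_unit_tensor_norming hp wT0 hX)].
- move=> t g h; change (
    scalar_re (scalar_of_real t * g T + (1 - scalar_of_real t) * h T) =
    t * scalar_re (g T) + (1 - t) * scalar_re (h T)).
  rewrite -scalar_of_real1 -scalar_of_realB scalar_reD !scalar_reM.
  by rewrite !scalar_re_real !scalar_im_real !mul0r !subr0.
- move=> _ [[a [u [hu a1 ->]]] _].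
  apply: le_trans (ler_norm _) _; apply: le_trans (scalar_re_le_abs _) _.
  exact: tensor_functional_le.
- by rewrite fT scalar_re_real.
Qed.
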